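(* Let $G$ be an $n$-vertex graph with minimum degree at least $6$. Let $L:V(G)\rightarrow P(\{1,2,3\})$ be a list assignment over the vertices of $G$. Then $L$-choosability of $G$ can be determined in $O(1.3196^{\,n_3+0.5\,n_2})$ time, where $n_i$ is the number of vertices of $G$ with list of size $i$, for $i\in\{2,3\}$.
   Context: $V(G)$ denotes the vertex set of $G$, and $P(\{1,2,3\})$ is the power set of $\{1,2,3\}$. A list assignment $L:V(G)\rightarrow P(\{1,2,3\})$ assigns to each vertex $v$ a list (set) of colors $L(v)\subseteq\{1,2,3\}$; the size of the list of $v$ is $|L(v)|$. A coloring of the vertices is proper if adjacent vertices receive different colors. $G$ is $L$-choosable if it has a proper list coloring with respect to $L$, i.e. a choice function mapping every vertex $v$ to a color in $L(v)$ such that the resulting coloring is proper. ''Determining $L$-choosability of $G$'' in a given time means that there is an algorithm which, given $G$ and $L$, decides within that time whether $G$ is $L$-choosable.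
   Formalization: The time bound proved is O((n+1)^k + 1.3196^(n_3+0.5 n_2)) for a fixed k: a polynomial in n is added, since with all lists of size at most 1 the stated bound would be constant time, too little to read the input. *)

(* Defs.v *)
From HB Require Import structures.
From mathcomp Require Import all_boot all_order all_algebra.
From mathcomp Require Import reals exp.

Set Implicit Arguments.
Unset Strict Implicit.
Unset Printing Implicit Defensive.

Import Order.TTheory GRing.Theory Num.Theory.

Local Open Scope nat_scope.

Record sgraph (T : finType) := SGraph {
  adj :> rel T;
  adj_sym : symmetric adj;
  adj_irrefl : irreflexive adj }.

Definition degree (T : finType) (G : sgraph T) (v : T) : nat :=
  #|[set u | G v u]|.

(* The colours 1, 2, 3 are the elements of 'I_3.  Empty lists are allowed. *)
Definition list_assignment (T : finType) := T -> {set 'I_3}.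

Definition choosable (T : finType) (G : sgraph T) (L : list_assignment T)
    : bool :=
  [exists f : {ffun T -> 'I_3},
    [forall v, f v \in L v] && [forall u, forall v, G u v ==> (f u != f v)]].

Definition nlist (T : finType) (L : list_assignment T) (i : nat) : nat :=
  #|[set v | #|L v| == i]|.

(* Algorithms are programs of a random access machine: registers indexed by   *)
(* nat (a program mentions finitely many of them), a memory indexed by nat    *)
(* and accessed through the registers, addition and truncated subtraction as  *)
(* the only arithmetic.  Control flow is structured; jumps would change       *)
(* running times by a constant factor only.                                   *)
Inductive prog : Type :=
| Skip
| Const of nat & nat
| Add of nat & nat & nat
| Sub of nat & nat & nat
| Get of nat & nat
| Put of nat & nat
| Seq of prog & prog
| If of nat & prog & prog
| While of nat & prog.

Record state := State { reg : nat -> nat; mem : nat -> nat }.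

Definition set_reg (s : state) (i x : nat) : state :=
  State [eta reg s with i |-> x] (mem s).

Definition set_mem (s : state) (a x : nat) : state :=
  State (reg s) [eta mem s with a |-> x].

Definition bitlen (x : nat) : nat := (trunc_log 2 x).+1.

(* [exec p s t s']: started in s, p halts in s' after time t.  Time is        *)
(* measured by the logarithmic cost criterion (an operation costs the total   *)
(* bit length of its operands): unit cost would let a program running in      *)
(* exponential time operate on exponentially long words in one step.          *)
Inductive exec : prog -> state -> nat -> state -> Prop :=
| exec_Skip s :
    exec Skip s 1 s
| exec_Const s i c :
    exec (Const i c) s (bitlen c) (set_reg s i c)
| exec_Add s i j k :
    exec (Add i j k) s (bitlen (reg s j) + bitlen (reg s k))
         (set_reg s i (reg s j + reg s k))
| exec_Sub s i j k :
    exec (Sub i j k) s (bitlen (reg s j) + bitlen (reg s k))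
         (set_reg s i (reg s j - reg s k))
| exec_Get s i j :
    exec (Get i j) s (bitlen (reg s j) + bitlen (mem s (reg s j)))
         (set_reg s i (mem s (reg s j)))
| exec_Put s i j :
    exec (Put i j) s (bitlen (reg s i) + bitlen (reg s j))
         (set_mem s (reg s i) (reg s j))
| exec_Seq p q s s' s'' t t' :
    exec p s t s' -> exec q s' t' s'' -> exec (Seq p q) s (t + t') s''
| exec_If_true i p q s t s' :
    reg s i != 0 -> exec p s t s' ->
    exec (If i p q) s (bitlen (reg s i) + t) s'
| exec_If_false i p q s t s' :
    reg s i = 0 -> exec q s t s' ->
    exec (If i p q) s (bitlen (reg s i) + t) s'
| exec_While_true i p s s' s'' t t' :
    reg s i != 0 -> exec p s t s' -> exec (While i p) s' t' s'' ->
    exec (While i p) s (bitlen (reg s i) + t + t') s''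
| exec_While_false i p s :
    reg s i = 0 -> exec (While i p) s (bitlen (reg s i)) s.

(* The number of vertices, the adjacency matrix row by row, and for each      *)
(* vertex the characteristic vector of its list.                              *)
Definition encode (T : finType) (G : sgraph T) (L : list_assignment T)
    : seq nat :=
  #|T| :: [seq nat_of_bool (G u v) | u <- enum T, v <- enum T]
       ++ [seq nat_of_bool (c \in L v) | v <- enum T, c <- enum 'I_3].

Definition init_state (w : seq nat) : state :=
  State (fun=> 0) (fun a => nth 0 w a).

(* The answer is read off register 0. *)
Definition decides_in (p : prog) (T : finType) (G : sgraph T)
    (L : list_assignment T) (t : nat) : Prop :=
  exists s' : state,
    exec p (init_state (encode G L)) t s' /\ reg s' 0 = choosable G L :> nat.

(* Main.v *)
Require Import Defs.
From HB Require Import structures.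
From mathcomp Require Import all_boot all_order all_algebra.
From mathcomp Require Import reals exp.
From mathcomp Require Import zify ring lra.

Set Implicit Arguments.
Unset Strict Implicit.
Unset Printing Implicit Defensive.

Import Order.TTheory GRing.Theory Num.Theory.

Local Open Scope nat_scope.

(** The program explores a search tree depth first; what has to be shown is that
    the tree is small and that each node costs polynomial time.

    A node of the tree carries a family of lists, first closed under unit
    propagation: a vertex left with one colour removes this colour from the lists
    of its neighbours.  Branching fixes a vertex to each of its colours in turn
    and propagates.  Sizes are counted in half units, [mass L = 2 n3 + n2], so
    that the exponent of the claimed bound is half the mass.

    First phase.  Branching on a vertex is cheap if the drops [D] of the mass
    over its colours satisfy [sum beta^-D <= 1], where [beta = 224/195]; this
    number is just above the fifth root of 2, and its square is still below
    1.3196.  As long as cheap branchings exist, the tree has at most [beta^mass]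
    leaves.  After propagation all neighbours of a three-coloured vertex have two
    or three colours, so there are at least six of them, and this makes many
    branchings cheap.  Where none is cheap, a two-coloured vertex has at most
    three three-coloured neighbours ([stuck_pair]), and a three-coloured vertex
    has two two-coloured neighbours, or one that has no other three-coloured
    neighbour ([stuck_triple]); a discharging argument then gives
    [2 n3 <= 3 n2] ([stuck_ratio]).

    Second phase.  The mass is now at least [8/3 n3], so a tree with at most
    [gamma^n3] leaves is good enough, where [gamma = 13/9] and
    [gamma^3 <= beta^8] ([switch_potential]).  Two-coloured vertices have become
    free, and the degrees no longer matter.  If fixing a three-coloured vertex [v]
    to a colour [c] touches no other three-coloured vertex, it may be done without
    loss.  If it touches only one, [y], then either it may be done, or [v] avoids
    [c] and [y] takes one of the colours that it would have lost; [n3] drops by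
    two on both sides, and [gamma^2 >= 2].  Otherwise [n3] drops by at least three
    for every colour of [v], and [gamma^3 >= 3] ([mild_solvable],
    [settle_potential]).  Without three-coloured vertices this is the usual
    polynomial algorithm for 2-SAT.

    The traversal keeps the pending nodes on a stack.  A measure of size linear in
    the number [n] of vertices decreases strictly along the edges of the tree, so
    the traversal visits at most (linear factor) x (number of leaves) nodes and
    its stack has linear height ([run_lists]).

    The machine program is written in a small language with arrays and with loops
    that run [n] times.  The number of operations of such a command is a
    polynomial in [n] that can be read off its text ([poly_ops]), and an operation
    lengthens the words in the registers by at most one bit, so that a polynomial
    number of operations on short words has polynomial logarithmic cost
    ([compile_ok]).  One round of the main loop is such a command and performs one
    step of the traversal ([step_spec]).  The remaining polynomial factor is
    absorbed by the gap between [beta^2] and 1.3196 ([absorb_poly]). *)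

(** * Unit propagation *)

Local Notation lists T := {ffun T -> {set 'I_3}} (only parsing).

Section Propagation.
Variables (T : finType) (G : sgraph T).
Implicit Types (L P : lists T) (u v x : T) (c : 'I_3).

Definition solves L (f : T -> 'I_3) :=
  (forall v, f v \in L v) /\ (forall u v, G u v -> f u != f v).

Lemma choosableP L : reflect (exists f, solves L f) (choosable G L).
Proof.
apply: (iffP existsP) => [[f /andP[/forallP fL /forallP fG]]|[f [fL fG]]].
  by exists f; split=> // u v; move/forallP/(_ v)/implyP: (fG u).
exists (finfun f); apply/andP; split; apply/forallP=> u; rewrite ?ffunE //.
by apply/forallP=> v; rewrite !ffunE; apply/implyP/fG.
Qed.

Definition sublist P L := forall v, P v \subset L v.

Lemma sublist_trans L1 L2 L3 : sublist L1 L2 -> sublist L2 L3 -> sublist L1 L3.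
Proof. by move=> s12 s23 v; apply: subset_trans (s12 v) (s23 v). Qed.

Lemma solves_sub P L f : sublist P L -> solves P f -> solves L f.
Proof. by move=> sPL [fP fG]; split=> // v; apply: (subsetP (sPL v)). Qed.

Lemma choosable_sub P L : sublist P L -> choosable G P -> choosable G L.
Proof.
by move=> sPL /choosableP[f fP]; apply/choosableP; exists f; apply: solves_sub fP.
Qed.

Definition dead L := nlist L 0 != 0.

Lemma deadP L : reflect (exists v, L v = set0) (dead L).
Proof.
rewrite /dead /nlist -lt0n; apply: (iffP card_gt0P) => -[v].
  by rewrite inE cards_eq0 => /eqP ?; exists v.
by move=> Lv; exists v; rewrite inE Lv cards0.
Qed.

Lemma alive_gt0 L v : ~~ dead L -> 0 < #|L v|.
Proof. by move/deadP=> nd; rewrite card_gt0; apply/eqP=> Lv; apply: nd; exists v. Qed.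

Lemma dead_not_choosable L : dead L -> choosable G L = false.
Proof.
move/deadP=> [v Lv]; apply/negbTE/negP=> /choosableP[f [/(_ v)]].
by rewrite Lv inE.
Qed.

Definition total L := \sum_v #|L v|.

Lemma total_le L : total L <= 3 * #|T|.
Proof.
rewrite mulnC -sum_nat_const; apply: leq_sum => v _.
by rewrite (leq_trans (max_card _)) // card_ord.
Qed.

Definition remove L u v : lists T :=
  if G u v && (#|L u| == 1)
  then [ffun x => if x == v then L x :\: L u else L x] else L.

Definition remove_row L u := foldl (fun L v => remove L u v) L (enum T).

Definition round L := foldl remove_row L (enum T).

(** A round that is not yet stationary removes at least one of the at most
    [3 * #|T|] colours, hence the number of rounds. *)
Definition propagate L := iter (3 * #|T|) round L.

Definition settled L :=
  forall u v, G u v -> #|L u| = 1 -> [disjoint L u & L v].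

Lemma remove_sub L u v : sublist (remove L u v) L.
Proof.
move=> x; rewrite /remove; case: ifP => // _; rewrite ffunE.
by case: ifP => // _; apply: subsetDl.
Qed.

(** A fold of shrinking operations that ends where it started did nothing at
    any point: this turns a fixpoint of a whole round of removals into a
    fixpoint of each single removal. *)
Lemma foldl_shrink (X : Type) (m : X -> nat) (A : eqType)
    (g : X -> A -> X) (s : seq A) (y : X) :
  (forall y a, g y a = y \/ m (g y a) < m y) ->
  (foldl g y s = y /\ {in s, forall a, g y a = y}) \/ m (foldl g y s) < m y.
Proof.
move=> dec; have le s' z : m (foldl g z s') <= m z.
  elim: s' z => //= a s' IH z; apply: leq_trans (IH _) _.
  by case: (dec z a) => [->|/ltnW].
elim: s => [|a s IH] /=; first by left.
case: (dec y a) => [e|lt]; last by right; apply: leq_ltn_trans (le _ _) lt.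
rewrite e; case: IH => [[e1 e2]|?]; last by right.
left; split=> // b; rewrite inE => /orP[/eqP->//|]; exact: e2.
Qed.

Lemma total_lt P L v :
  sublist P L -> #|P v| < #|L v| -> total P < total L.
Proof.
move=> sPL lt; rewrite /total (bigD1 v) //= [X in _ < X](bigD1 v) //=.
rewrite -addSn leq_add //; apply: leq_sum => x _; exact: subset_leq_card.
Qed.

Lemma remove_dec L u v : remove L u v = L \/ total (remove L u v) < total L.
Proof.
have [e|ne] := eqVneq (remove L u v) L; [by left | right].
apply: (@total_lt _ _ v); first exact: remove_sub.
apply: proper_card; rewrite properEneq remove_sub andbT.
apply: contra ne => /eqP e; apply/eqP/ffunP=> x.
have [-> //|nx] := eqVneq x v.
by rewrite /remove; case: ifP => // _; rewrite ffunE (negPf nx).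
Qed.

Lemma remove_row_dec L u :
  remove_row L u = L \/ total (remove_row L u) < total L.
Proof.
by case: (foldl_shrink (enum T) L (fun L => remove_dec L u)) => [[]|];
  [left | right].
Qed.

Lemma round_settled L : round L = L -> settled L.
Proof.
case: (foldl_shrink (enum T) L remove_row_dec) => [[_ rows] _ u v Guv Lu|];
  last by rewrite /round => + e; rewrite e ltnn.
have eu : remove_row L u = L by apply: rows; rewrite mem_enum.
case: (foldl_shrink (enum T) L (fun L => remove_dec L u)) => [[_ cols]|];
  last by rewrite -/(remove_row L u) eu ltnn.
have /ffunP/(_ v) : remove L u v = L by apply: cols; rewrite mem_enum.
rewrite /remove Guv Lu /= ffunE eqxx => e.
by rewrite disjoint_sym -e -setI_eq0 setIDAC setDIl setDv setI0.
Qed.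

Lemma iter_fixpoint (X : Type) (m : X -> nat) (f : X -> X) k (y : X) :
  (forall y, f y = y \/ m (f y) < m y) -> m y <= k ->
  f (iter k f y) = iter k f y.
Proof.
move=> dec; elim: k y => [|k IH] y le.
  by case: (dec y) => //; rewrite ltnNge (leq_trans le).
case: (dec y) => [e|lt]; first by rewrite !iter_fix.
by rewrite iterSr; apply: IH; rewrite -ltnS (leq_trans lt).
Qed.

Lemma propagate_settled L : settled (propagate L).
Proof.
apply: round_settled; apply: (iter_fixpoint (m := total)) (total_le L) => {}L.
by case: (foldl_shrink (enum T) L remove_row_dec) => [[]|]; [left | right].
Qed.

(** Propagation is a sequence of removals, so that whatever single removals
    preserve holds of its result. *)
Lemma propagate_ind (Q : lists T -> Prop) L :
  (forall L u v, Q L -> Q (remove L u v)) -> Q L -> Q (propagate L).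
Proof.
move=> step QL; rewrite /propagate; elim: (_ * _) => //= k; move: (iter _ _ _).
move=> {QL}L QL; rewrite /round; elim: (enum T) L QL => //= u s IH L QL.
apply: IH; rewrite /remove_row.
by elim: (enum T) L QL => //= v r IH L QL; apply: IH; apply: step.
Qed.

Lemma propagate_sub L : sublist (propagate L) L.
Proof.
apply: (@propagate_ind (fun P => sublist P L)) => [P u v sPL|v //].
exact: sublist_trans (@remove_sub _ _ _) sPL.
Qed.

Lemma solves_propagate L f : solves L f -> solves (propagate L) f.
Proof.
apply: (@propagate_ind (solves^~ f)) => {}L u v [fL fG]; split=> // x.
rewrite /remove; case: ifP => [/andP[Guv /cards1P[c Lu]]|_]; last exact: fL.
rewrite ffunE; case: eqP => [->|_]; last exact: fL.
rewrite inE fL andbT Lu inE eq_sym.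
by move: (fL u) (fG u v Guv); rewrite Lu inE => /eqP->.
Qed.

Lemma choosable_propagate L : choosable G (propagate L) = choosable G L.
Proof.
apply/idP/idP; first exact/choosable_sub/propagate_sub.
case/choosableP=> f /solves_propagate fP; apply/choosableP; by exists f.
Qed.

(** A colouring of the graph can be overruled on the vertices that [P] leaves
    one colour, provided that it respects [P] elsewhere: [P] is settled, so a
    colour forced by [P] occurs in no list of a neighbour. *)
Lemma settled_autarky P f :
  settled P -> ~~ dead P ->
  (forall u v, G u v -> f u != f v) ->
  (forall v, 2 <= #|P v| -> f v \in P v) -> choosable G P.
Proof.
move=> cP aP fG fP.
pose g v := if [pick c in P v] is Some c then
              (if #|P v| == 1 then c else f v) else f v.
have gP v : g v \in P v.
  rewrite /g; have := alive_gt0 v aP; case: pickP => [c Pc _|e].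
    by case: (#|P v| =P 1) (fP v) (alive_gt0 v aP) => // n1 h p; apply: h; lia.
  by rewrite (eq_card0 e).
apply/choosableP; exists g; split=> // u v Guv; apply/eqP=> eg.
have g2 x : #|P x| != 1 -> g x = f x.
  by rewrite /g => /negPf->; case: pickP.
have [u1|u1] := eqVneq #|P u| 1.
  by move/disjointFr/(_ (gP u)): (cP u v Guv u1); rewrite eg gP.
have [v1|v1] := eqVneq #|P v| 1.
  have Gvu : G v u by rewrite (adj_sym G).
  by move/disjointFr/(_ (gP v)): (cP v u Gvu v1); rewrite -eg gP.
by move: (fG u v Guv); rewrite -!g2 // eg eqxx.
Qed.

Lemma singletons_choosable L :
  settled L -> ~~ dead L -> nlist L 2 = 0 -> nlist L 3 = 0 -> choosable G L.
Proof.
move=> cL aL n2 n3.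
have L1 v : #|L v| = 1.
  have n i : nlist L i = 0 -> #|L v| != i.
    by move/eqP; rewrite cards_eq0 => /eqP/setP/(_ v); rewrite !inE => ->.
  have := subset_leq_card (subsetT (L v)); rewrite cardsT card_ord.
  by move: (n _ n2) (n _ n3) (alive_gt0 v aL); case: #|_| => [|[|[|[|]]]].
have pL v : exists c, c \in L v by apply/card_gt0P/alive_gt0.
apply/choosableP; exists (fun v => xchoose (pL v)).
have fL v := xchooseP (pL v).
split=> // u v Guv; apply/eqP=> e.
by move/disjointFr/(_ (fL u)): (cL u v Guv (L1 u)); rewrite e fL.
Qed.

End Propagation.

(** * Branching and its cost *)

Lemma sum_mem (X : finType) (A : {set X}) : \sum_x (x \in A) = #|A|.
Proof.
by rewrite -sum1_card [RHS]big_mkcond; apply: eq_bigr => x _; case: (_ \in _).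
Qed.

Lemma sum_pred1 (X : finType) (x : X) : \sum_y (y == x) = 1.
Proof. by rewrite (bigD1 x) //= eqxx big1 // => y /negPf->. Qed.

Section Branching.
Variables (T : finType) (G : sgraph T).
Implicit Types (L P : lists T) (u v x : T) (c : 'I_3) (m : bool).

Definition restrict L v c : lists T :=
  [ffun x => if x == v then L x :&: [set c] else L x].

Definition branch L v c := propagate G (restrict L v c).

(** Twice the exponent of the claimed bound. *)
Definition mass L := 2 * nlist L 3 + nlist L 2.

Definition wt (k : nat) := 2 * (k == 3) + (k == 2).

(** An upper bound for [100 * beta ^- D], where [beta] is the branching factor
    of the first phase. *)
Definition score (D : nat) :=
  if D < 5 then 101 else if D < 7 then 50 else
  if D < 8 then 38 else if D < 9 then 33 else 29.

(** A dead branch is never explored.  A colour outside the list of [v] empties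
    this list and thus needs no separate treatment. *)
Definition weight L v c :=
  if dead (branch L v c) then 0 else score (mass L - mass (branch L v c)).

Definition cheap L v := \sum_(c < 3) weight L v c <= 100.

Lemma card_list L v : #|L v| <= 3.
Proof. by rewrite (leq_trans (max_card _)) ?card_ord. Qed.

Lemma nlistE L i : nlist L i = \sum_v (#|L v| == i).
Proof.
rewrite /nlist -sum1_card big_mkcond /=; apply: eq_bigr => v _.
by rewrite inE; case: (_ == _).
Qed.

Lemma massE L : mass L = \sum_v wt #|L v|.
Proof. by rewrite /mass !nlistE big_distrr /= -big_split. Qed.

Lemma mass_drop L P (e : T -> nat) :
  (forall v, e v + wt #|P v| <= wt #|L v|) -> \sum_v e v + mass P <= mass L.
Proof. by move=> le; rewrite !massE -big_split; apply: leq_sum. Qed.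

Lemma nlist3_drop L P (e : T -> nat) :
  (forall v, e v + (#|P v| == 3) <= (#|L v| == 3)) ->
  \sum_v e v + nlist P 3 <= nlist L 3.
Proof. by move=> le; rewrite !nlistE -big_split; apply: leq_sum. Qed.

Lemma wt_sub P L v : sublist P L -> wt #|P v| <= wt #|L v|.
Proof.
move/(_ v)/subset_leq_card; have := card_list L v.
by case: #|L v| => [|[|[|[|]]]] //; case: #|P v| => [|[|[|[|]]]].
Qed.

Lemma mass_sub P L : sublist P L -> mass P <= mass L.
Proof. by move=> sPL; rewrite !massE; apply: leq_sum => v _; apply: wt_sub. Qed.

Lemma nlist3_sub P L : sublist P L -> nlist P 3 <= nlist L 3.
Proof.
move=> sPL; rewrite !nlistE; apply: leq_sum => v _.
move: (subset_leq_card (sPL v)) (card_list L v).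
by do 2![case: eqP] => //; lia.
Qed.

Lemma restrict_sub L v c : sublist (restrict L v c) L.
Proof. by move=> x; rewrite ffunE; case: eqP => // _; apply: subsetIl. Qed.

Lemma branch_sub L v c : sublist (branch L v c) L.
Proof. exact: sublist_trans (@propagate_sub _ _ _) (@restrict_sub _ _ _). Qed.

Lemma branch_root L v c : branch L v c v \subset [set c].
Proof.
apply: subset_trans (propagate_sub _ _ _) _.
by rewrite ffunE eqxx subsetIr.
Qed.

Lemma branch_notin L v c : c \notin L v -> dead (branch L v c).
Proof.
move=> cL; apply/deadP; exists v; apply/eqP; rewrite -subset0.
apply/subsetP=> d dB; move: (subsetP (branch_root L v c) _ dB) => /[!inE]/eqP e.
by rewrite -e (subsetP (@branch_sub L v c v) _ dB) in cL.
Qed.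

Lemma branch_rootE L v c :
  ~~ dead (branch L v c) -> branch L v c v = [set c].
Proof.
move=> /(alive_gt0 v) p; apply/eqP; rewrite eqEcard branch_root cards1.
by rewrite p.
Qed.

Lemma solves_branch L v f : solves G L f -> solves G (branch L v (f v)) f.
Proof.
move=> [fL fG]; apply: solves_propagate; split=> // x.
by rewrite ffunE; case: eqP => [->|//]; rewrite !inE fL eqxx.
Qed.

Lemma settled_notin P u v c :
  settled G P -> G u v -> P u = [set c] -> c \notin P v.
Proof.
move=> cP Guv Pu; have := cP u v Guv; rewrite Pu cards1 => /(_ erefl).
by rewrite disjoints1.
Qed.

Lemma card_notin1 (A : {set 'I_3}) c : c \notin A -> #|A| <= 2.
Proof.
move=> cA; have := subset_leq_card (_ : A \subset ~: [set c]).
rewrite cardsC1 card_ord; apply; apply/subsetP=> d dA; rewrite !inE.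
by apply: contraNneq cA => <-.
Qed.

Lemma card_notin2 (A : {set 'I_3}) a b :
  a != b -> a \notin A -> b \notin A -> #|A| <= 1.
Proof.
move=> ab aA bA; have sub : A \subset ~: [set a; b].
  apply/subsetP=> d dA; rewrite !inE negb_or.
  by apply/andP; split; [apply: contraNneq aA | apply: contraNneq bA] => <-.
have := subset_leq_card sub.
by have := cardsC [set a; b]; rewrite cards2 ab card_ord; lia.
Qed.

Lemma score_anti D E : D <= E -> score E <= score D.
Proof.
have step k : score k.+1 <= score k by do 9![case: k => // k].
by move=> /subnKC<-; elim: (E - D) => [|k IH]; rewrite ?addn0 // addnS (leq_trans _ IH).
Qed.

Lemma weight_le L v c k :
  (~~ dead (branch L v c) -> k + mass (branch L v c) <= mass L) ->
  weight L v c <= score k.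
Proof.
rewrite /weight; case: ifP => [_ _|_ le]; first by [].
by apply: score_anti; have := le isT; lia.
Qed.

(** * Where no branching is cheap *)

Section Stuck.
Variable L : lists T.
Hypotheses (cL : settled G L) (aL : ~~ dead L).
Hypothesis deg6 : forall v, 6 <= degree G v.
Hypothesis stuck : forall v, ~~ cheap L v.

Let nb (i : nat) u := [set x | G u x & #|L x| == i].

Lemma in_nb i u x : x \in nb i u = G u x && (#|L x| == i).
Proof. by rewrite inE. Qed.

Lemma branch_nb3 v c x :
  ~~ dead (branch L v c) -> x \in nb 3 v ->
  wt #|branch L v c x| < wt #|L x|.
Proof.
move=> aB; rewrite in_nb => /andP[Gvx /eqP->].
have := card_notin1 (settled_notin (@propagate_settled _ G _) Gvx (branch_rootE aB)).
by rewrite -/(branch L v c); case: #|_| => [|[|[|]]].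
Qed.

Lemma root_wt v c : ~~ dead (branch L v c) -> wt #|branch L v c v| = 0.
Proof. by move/branch_rootE->; rewrite cards1. Qed.

Lemma nb_root i v : v \notin nb i v.
Proof. by rewrite in_nb adj_irrefl. Qed.

(** Whichever of its colours a two-coloured vertex takes, each of its
    three-coloured neighbours loses a colour.  Four such neighbours make the
    drops (5, 5). *)
Lemma stuck_pair u : #|L u| = 2 -> #|nb 3 u| <= 3.
Proof.
move=> u2; rewrite leqNgt; apply/negP=> d4; move/negP: (stuck u); apply.
have le c : weight L u c <= (c \in L u) * 50.
  case: (boolP (c \in L u)) => [_|/branch_notin d]; last by rewrite /weight d.
  apply: (@weight_le _ _ _ 5) => aB.
  apply: (@leq_trans (\sum_x ((x == u) + (x \in nb 3 u)) + mass (branch L u c))).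
    by rewrite big_split /= sum_mem sum_pred1; lia.
  apply: mass_drop => x; have [->|xu] := eqVneq x u.
    by rewrite root_wt // (negPf (nb_root _ _)) u2.
  case: (boolP (x \in _)) => [/(branch_nb3 aB) //|_].
  exact: wt_sub (@branch_sub _ _ _).
apply: leq_trans (leq_sum _ (fun c _ => le c)) _.
by rewrite -big_distrl /= sum_mem u2.
Qed.

(** A one-coloured neighbour would already have removed a colour from the full
    list of [v]. *)
Lemma nb_size v : #|L v| = 3 -> 6 <= #|nb 2 v| + #|nb 3 v|.
Proof.
move=> v3; apply: leq_trans (deg6 v) _; rewrite -cardsUI.
apply: leq_trans (leq_addr _ _); apply: subset_leq_card.
apply/subsetP=> x; rewrite !inE => Gvx; rewrite Gvx /=.
have Gxv : G x v by rewrite (adj_sym G).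
have Lv : L v = setT by apply/eqP; rewrite eqEcard subsetT cardsT card_ord v3.
have := alive_gt0 x aL; have := cL Gxv; have := card_list L x.
case e: #|L x| => [|[|[|[|]]]] // _ /(_ erefl).
by rewrite Lv -setI_eq0 setIT => /eqP e0; rewrite e0 cards0 in e.
Qed.

(** With three-coloured neighbours only, the drops are at least (8, 8, 8).
    With a single two-coloured neighbour [u] they are at least (8, 8, 7), as [u]
    is forced by only two of the colours of [v].  But a further three-coloured
    neighbour [x] of [u] improves both of these branches: it loses the colour
    taken by [u], which is a loss that the count of the neighbours of [v] has
    missed whether or not [x] is one of them.  Drops (9, 9, 7) are cheap. *)
Lemma stuck_triple v :
  #|L v| = 3 -> 4 <= \sum_(u in nb 2 v) 6 %/ #|nb 3 u|.
Proof.
move=> v3; have n6 := nb_size v3.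
have nbv u : u \in nb 2 v -> v \in nb 3 u.
  by rewrite !in_nb v3 (adj_sym G) eqxx andbT => /andP[].
have le_part u : u \in nb 2 v -> 2 <= 6 %/ #|nb 3 u|.
  move=> uv; have := nbv u uv; rewrite in_nb => /andP[_ _].
  have /stuck_pair : #|L u| = 2 by move: uv; rewrite in_nb => /andP[_ /eqP].
  have : 0 < #|nb 3 u| by apply/card_gt0P; exists v; apply: nbv.
  by case: #|_| => [|[|[|[|]]]].
have [k2|] := leqP 2 #|nb 2 v|.
  apply: (@leq_trans (\sum_(u in nb 2 v) 2)); last exact: leq_sum.
  by rewrite sum_nat_const; lia.
(* The vertex itself drops by two, its three-coloured neighbours by one. *)
have e0 c x : ~~ dead (branch L v c) ->
    2 * (x == v) + (x \in nb 3 v) + wt #|branch L v c x| <= wt #|L x|.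
  move=> aB; have [->|xv] := eqVneq x v.
    by rewrite root_wt // (negPf (nb_root _ _)) v3.
  case: (boolP (x \in _)) => [/(branch_nb3 aB) //|_].
  exact: wt_sub (@branch_sub _ _ _).
rewrite ltnS leq_eqVlt ltnS leqn0 => /orP[/cards1P[u nb2]|/eqP k0]; last first.
  case/negP: (stuck v); apply: leq_trans (_ : \sum_(c < 3) 33 <= _).
    apply: leq_sum => c _; apply: (@weight_le _ _ _ 8) => aB.
    apply: leq_trans (mass_drop (fun x => e0 c x aB)).
    by rewrite big_split /= -big_distrr /= sum_pred1 sum_mem; lia.
  by rewrite sum_nat_const card_ord.
have uv : u \in nb 2 v by rewrite nb2 inE.
rewrite nb2 big_set1.
have [->//|d1] := eqVneq #|nb 3 u| 1.
have [Gvu /eqP u2] : G v u /\ #|L u| == 2 by move: uv; rewrite in_nb => /andP.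
have /card_gt0P[x] : 0 < #|nb 3 u :\ v|.
  by have := cardsD1 v (nb 3 u); rewrite nbv //; lia.
rewrite !inE => /and3P[xv Gux /eqP x3].
have ux : x != u by apply: contra_eqN x3 => /eqP->; rewrite u2.
have vu : u != v by apply: contra_eqN u2 => /eqP->; rewrite v3.
case/negP: (stuck v).
(* Scores 29 for the colours of [u], and 38 for the third colour. *)
apply: leq_trans (_ : \sum_(c < 3) (29 + 9 * (c \in ~: L u)) <= _); last first.
  rewrite big_split /= sum_nat_const card_ord -big_distrr /=.
  rewrite sum_mem; have := cardsC (L u); rewrite u2 card_ord ; by move=> /(@addnI 2 _ 1) ->.
apply: leq_sum => a _; rewrite inE; have [aLu|aLu] /= := boolP (a \in L u); last first.
  apply: (@weight_le _ _ _ 7) => aB.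
  apply: leq_trans (mass_drop (fun x => e0 a x aB)).
  rewrite big_split /= -big_distrr /= sum_pred1 sum_mem leq_add2r.
  by move: n6; rewrite nb2 cards1 -(leq_add2l 1).
apply: (@weight_le _ _ _ 9) => aB; set P := branch L v a in aB *.
have cP : settled G P := @propagate_settled _ G _.
have Pv : P v = [set a] := branch_rootE aB.
have aPu : a \notin P u := settled_notin cP Gvu Pv.
have [b bPu] : exists b, b \in P u by apply/card_gt0P/alive_gt0.
have Pu : P u = [set b].
  apply/eqP; rewrite eq_sym eqEcard sub1set bPu cards1.
  have : P u \subset L u :\ a.
    apply/subsetP=> d dP; rewrite !inE (subsetP (@branch_sub L v a u)) // andbT.
    by apply: contraNneq aPu => <-.
  have e1 : #|L u :\ a| = 1 by move: u2; rewrite (cardsD1 a) aLu => -[].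
  by move/subset_leq_card; rewrite e1.
(* Now [x] has lost [b], and also [a] if it is a neighbour of [v]. *)
have bPx : b \notin P x := settled_notin cP Gux Pu.
apply: (@leq_trans (\sum_z (2 * (z == v) + (z \in nb 3 v) + ((z == u) + (z == x))) + mass P)).
  rewrite 2!big_split /= -big_distrr /= big_split /= !sum_pred1 sum_mem.
  by rewrite leq_add2r; move: n6; rewrite nb2 cards1 -(leq_add2l 3) addnAC.
apply: mass_drop => z.
have [->|zu] := eqVneq z u.
  by rewrite in_nb (negPf vu) (_ : (u == x) = false) 1?eq_sym ?(negPf ux) // Pu cards1 u2 andbF.
have [->|zx] := eqVneq z x; last by rewrite !addn0; apply: e0.
rewrite (negPf xv) in_nb x3 eqxx andbT !add0n.
case: (boolP (G v x)) => [Gvx|_] /=.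
  have := card_notin2 _ (settled_notin cP Gvx Pv) bPx.
  have ab : a != b by apply: contraNneq aPu => ->.
  by move/(_ ab); case: #|_| => [|[|]].
by have := card_notin1 bPx; case: #|_| => [|[|[|]]].
Qed.

(** Discharging: a two-coloured vertex splits six units evenly among its
    three-coloured neighbours, and each of these collects at least four. *)
Lemma stuck_ratio : 2 * nlist L 3 <= 3 * nlist L 2.
Proof.
suff: nlist L 3 * 4 <= nlist L 2 * 6 by lia.
rewrite /nlist -!sum_nat_const.
apply: (@leq_trans (\sum_(v in [set v | #|L v| == 3])
   \sum_(u in nb 2 v) 6 %/ #|nb 3 u|)).
  by apply: leq_sum => v; rewrite inE => /eqP; apply: stuck_triple.
rewrite (exchange_big_dep (mem [set v | #|L v| == 2])) /=; last first.
  by move=> v u _; rewrite !inE => /andP[].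
apply: leq_sum => u; rewrite inE => /eqP u2.
rewrite sum_nat_cond_const (_ : #|_| = #|nb 3 u|) ?leq_divMr // 1?mulnC ?leq_divM //.
apply: eq_card => v; rewrite !inE u2 eqxx andbT (adj_sym G).
by rewrite andbC.
Qed.

End Stuck.
End Branching.

(** * The search tree *)

Definition colours : seq 'I_3 :=
  [:: @Ordinal 3 0 isT; @Ordinal 3 1 isT; @Ordinal 3 2 isT].

Lemma mem_colours c : c \in colours.
Proof. by case: c => [[|[|[|]]]]. Qed.

Section Search.
Variables (T : finType) (G : sgraph T).
Implicit Types (L P : lists T) (u v x : T) (c : 'I_3) (m : bool).

Local Notation frame := (bool * lists T)%type (only parsing).

(** A node of the tree is a pair of a flag, set in the second phase, and a
    family of lists.  The order of the colours is the one in which a stack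
    returns them. *)
Definition kids m L v : seq frame :=
  [seq (m, branch G L v c) | c <- rev colours & ~~ dead (branch G L v c)].

(** Two-coloured vertices are branched upon only if there is nothing else: then
    each of their colours is contradictory or can be fixed without loss. *)
Definition ready L v :=
  (#|L v| == 3) || (#|L v| == 2) && (nlist L 3 == 0).

(** A three-coloured [v] itself accounts for one of the two three-coloured
    vertices that may be lost. *)
Definition mild L v c :=
  ~~ dead (branch G L v c) && (nlist L 3 - nlist (branch G L v c) 3 <= 2).

(** The alternative to a mild branch [P]: the vertex [v] avoids its colour [c]
    and the other touched vertex takes a colour that [P] forbids.  As [P v] is
    the singleton of [c], one formula covers both vertices. *)
Definition oppose L P : lists T :=
  [ffun x => if (#|L x| == 3) && (#|P x| < 3) then L x :\: P x else L x].

Definition mild_kids L v c : seq frame :=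
  let P := branch G L v c in
  (if nlist L 3 - nlist P 3 == 2 then [:: (true, oppose L P)] else [::])
  ++ [:: (true, P)].

Definition settle L v : seq frame :=
  if [seq c <- colours | mild L v c] is c :: _ then mild_kids L v c
  else kids true L v.

Definition suits m L v := if m then ready L v else cheap G L v.

Definition expand m L : seq frame :=
  if [seq v <- enum T | suits m L v] is v :: _ then
    if m then settle L v else kids m L v
  else [:: (true, L)].

(** The flag contributes because passing to the second phase changes nothing
    but the flag. *)
Definition rank (f : frame) := mass f.2 + ~~ f.1.

Definition solvable (f : frame) := choosable G f.2.

Lemma kids_solvable m L v : has solvable (kids m L v) = choosable G L.
Proof.
apply/hasP/idP => [[f /mapP[c _ ->]]|/choosableP[f fL]].
  exact: choosable_sub (@branch_sub _ _ _ _ _).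
have fB := solves_branch v fL.
have cB : choosable G (branch G L v (f v)) by apply/choosableP; exists f.
exists (m, branch G L v (f v)) => //; apply: map_f.
rewrite mem_filter mem_rev mem_colours andbT.
by apply/negP=> /(dead_not_choosable G); rewrite cB.
Qed.

Definition touched L P := [set x | (#|L x| == 3) && (#|P x| < 3)].

Lemma card_touched L P :
  sublist P L -> #|touched L P| + nlist P 3 = nlist L 3.
Proof.
move=> sPL; rewrite /touched !nlistE -sum1_card big_mkcond -big_split /=.
apply: eq_bigr => x _; rewrite inE.
have := subset_leq_card (sPL x); have := card_list L x.
by do 2![case: eqP => //=]; case: ltnP => //=; lia.
Qed.

Lemma oppose_sub L P : sublist (oppose L P) L.
Proof. by move=> x; rewrite ffunE; case: ifP => // _; apply: subsetDl. Qed.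

Lemma touched_root L v c :
  ~~ dead (branch G L v c) -> #|L v| = 3 -> v \in touched L (branch G L v c).
Proof. by move=> aB v3; rewrite inE v3 branch_rootE // cards1. Qed.

Lemma nlist_eq0 L i : nlist L i = 0 -> forall x, #|L x| != i.
Proof.
move=> /eqP; rewrite cards_eq0 => /eqP/setP e x.
by have := e x; rewrite !inE => ->.
Qed.

(** A solution that respects the branch on the touched three-coloured vertices
    can be overruled by it: elsewhere the branch leaves the list unchanged or
    with a single colour. *)
Lemma branch_autarky L v c f :
  ready L v -> ~~ dead (branch G L v c) -> solves G L f ->
  (forall x, x != v -> x \in touched L (branch G L v c) ->
     f x \in branch G L v c x) ->
  choosable G (branch G L v c).
Proof.
set P := branch G L v c => rv aB [fL fG] ok.
have sPL : sublist P L := @branch_sub _ _ _ _ _.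
apply: (@settled_autarky _ G P f (@propagate_settled _ G _) aB fG) => x x2.
have [ex|] := eqVneq (P x) (L x); first by rewrite ex.
rewrite eqEcard sPL /= -ltnNge => lt.
have x3 : #|L x| = 3.
  by apply/eqP; rewrite eqn_leq card_list (leq_ltn_trans x2 lt).
apply: ok; first by apply: contraTneq x2 => ->; rewrite [P v]branch_rootE // cards1.
by rewrite inE x3 eqxx (leq_trans lt) // x3.
Qed.

(** If a solution of [L] breaks the branch, it does so at the other touched
    vertex [y].  Then it does not give [v] the colour [c], since it would solve
    the branch otherwise; so it solves the opposed lists. *)
Lemma mild_solvable L v c :
  ready L v -> mild L v c -> has solvable (mild_kids L v c) = choosable G L.
Proof.
rewrite /mild /mild_kids; set P := branch G L v c => rv /andP[aB d2].
have sPL : sublist P L := @branch_sub _ _ _ _ _.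
have tN := card_touched sPL.
rewrite has_cat has_seq1; apply/idP/idP => [/orP[]|].
- case: ifP => // _; rewrite has_seq1; apply/choosable_sub/oppose_sub.
- exact: choosable_sub.
case/choosableP=> f fL.
have [/forallP ok|] :=
    boolP [forall x, (x != v) && (x \in touched L P) ==> (f x \in P x)].
  apply/orP; right; apply: (branch_autarky rv aB fL) => x xv xt.
  by have /implyP := ok x; rewrite xv xt; apply.
rewrite negb_forall => /existsP[y]; rewrite negb_imply => /andP[/andP[yv yt] fy].
have y3 : #|L y| == 3 by move: yt; rewrite inE => /andP[].
have v3 : #|L v| = 3.
  case/orP: rv => [/eqP//|/andP[_ /eqP/nlist_eq0/(_ y)]]; by rewrite y3.
have vt := touched_root aB v3; rewrite -/P in vt.
have sub : [set v; y] \subset touched L P.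
  by apply/subsetP=> z; rewrite !inE => /orP[]/eqP->; move: vt yt; rewrite !inE.
have := subset_leq_card sub; rewrite cards2 eq_sym yv => t2.
have -> : nlist L 3 - nlist P 3 == 2 by lia.
have /eqP et : [set v; y] == touched L P.
  by rewrite eqEcard sub cards2 eq_sym yv /=; lia.
apply/orP; left; rewrite has_seq1; apply/choosableP; exists f.
have [fLv fG] := fL; split=> // x; rewrite ffunE.
case: ifP => // xt; have : x \in touched L P by rewrite inE.
rewrite -et !inE => /orP[]/eqP->; rewrite fLv andbT //.
rewrite [P v]branch_rootE // inE; apply: contraNneq fy => fvc.
by have [] := solves_branch v fL; rewrite fvc => + _; apply.
Qed.

Lemma expand_solvable m L : has solvable (expand m L) = choosable G L.
Proof.
rewrite /expand; case e: [seq v <- enum T | suits m L v] => [|v s].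
  by rewrite has_seq1.
have : v \in [seq v <- enum T | suits m L v] by rewrite e mem_head.
rewrite mem_filter mem_enum andbT /suits; case: m {e} => sv; last exact: kids_solvable.
rewrite /settle; case e: [seq c <- colours | mild L v c] => [|c r].
  exact: kids_solvable.
have : c \in [seq c <- colours | mild L v c] by rewrite e mem_head.
by rewrite mem_filter => /andP[mc _]; apply: mild_solvable.
Qed.

Lemma size_kids m L v : size (kids m L v) <= 3.
Proof. by rewrite size_map size_filter (leq_trans (count_size _ _)). Qed.

Lemma size_expand m L : size (expand m L) <= 3.
Proof.
rewrite /expand; case: filter => // v _; case: m; last exact: size_kids.
rewrite /settle; case: filter => [|c _]; first exact: size_kids.
by rewrite size_cat; case: ifP.
Qed.

Lemma mass_lt P L v :
  sublist P L -> wt #|P v| < wt #|L v| -> mass P < mass L.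
Proof.
move=> sPL lt; apply: leq_trans (mass_drop (P := P) (e := fun x => x == v) _).
  by rewrite (bigD1 v) //= eqxx; lia.
by move=> x; case: eqP => [->//|_]; apply: wt_sub.
Qed.

Lemma ready_mass L v c :
  ready L v -> ~~ dead (branch G L v c) -> mass (branch G L v c) < mass L.
Proof.
move=> rv aB; apply: (@mass_lt _ _ v (@branch_sub _ _ _ _ _)).
rewrite branch_rootE // cards1.
by case/orP: rv => [/eqP->|/andP[/eqP-> _]].
Qed.

(** A drop below five has a score above 100. *)
Lemma cheap_mass L v c :
  cheap G L v -> ~~ dead (branch G L v c) -> mass (branch G L v c) < mass L.
Proof.
rewrite /cheap (bigD1 c) //= => le aB; rewrite ltnNge; apply/negP=> ge.
move: le; rewrite {1}/weight (negPf aB).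
by have -> : mass L - mass (branch G L v c) = 0 by lia.
Qed.

Lemma ready_exists L :
  (nlist L 3 + nlist L 2 != 0) -> exists v, ready L v.
Proof.
have [n3|n3 _] := eqVneq (nlist L 3) 0.
  rewrite n3 add0n -lt0n => /card_gt0P[v]; rewrite inE => v2.
  by exists v; rewrite /ready v2 n3 orbT.
have /card_gt0P[v] : 0 < nlist L 3 by rewrite lt0n.
by rewrite inE => v3; exists v; rewrite /ready v3.
Qed.

Lemma expand_rank m L f :
  nlist L 3 + nlist L 2 != 0 -> f \in expand m L -> rank f < rank (m, L).
Proof.
move=> nz; rewrite /expand; case e: [seq v <- enum T | suits m L v] => [|v s].
  case: m e => [|_]; last first.
    by rewrite inE => /eqP->; rewrite /rank /= addn0 addn1.
  have [v rv] := ready_exists nz => e.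
  have : v \in [seq v <- enum T | suits true L v] by rewrite mem_filter mem_enum andbT.
  by rewrite e.
have : v \in [seq v <- enum T | suits m L v] by rewrite e mem_head.
have kidsP m' : (forall c, ~~ dead (branch G L v c) -> mass (branch G L v c) < mass L) ->
    f \in kids m' L v -> rank f < rank (m', L).
  move=> lt /mapP[c]; rewrite mem_filter => /andP[aB _] ->.
  by rewrite /rank /= ltn_add2r lt.
rewrite mem_filter mem_enum andbT /suits; case: m {e} => sv; last first.
  by apply: kidsP => c; apply: cheap_mass.
rewrite /settle; case e: [seq c <- colours | mild L v c] => [|c r].
  by apply: kidsP => c; apply: ready_mass.
have : c \in [seq c <- colours | mild L v c] by rewrite e mem_head.
rewrite mem_filter => /andP[/andP[aB d2] _]; rewrite mem_cat inE => /orP[|/eqP->]; last first.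
  by rewrite /rank /= ltn_add2r ready_mass.
case: ifP => // /eqP d; rewrite inE => /eqP->; rewrite /rank /= ltn_add2r.
apply: (@mass_lt _ _ v (@oppose_sub _ _)).
have v3 : #|L v| = 3.
  by case/orP: sv => [/eqP//|/andP[_ /eqP n3]]; rewrite n3 in d.
have := touched_root aB v3; rewrite inE => tv; rewrite ffunE tv v3.
have := cardsID (branch G L v c v) (L v); rewrite v3.
have /setIidPr -> : branch G L v c v \subset L v by apply: branch_sub.
by rewrite branch_rootE // cards1 => /(@addnI 1 _ 2) ->.
Qed.

(** * The potential *)

Section Potential.
Variable R : realFieldType.
Local Open Scope ring_scope.

(** The constants satisfy [2 <= beta ^ 5], [beta ^ 2 < 1.3196],
    [3 <= gamma ^ 3] and [gamma ^ 3 <= beta ^ 8]. *)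
Definition beta : R := 224 / 195.
Definition gamma : R := 13 / 9.

Lemma beta_ge1 : 1 <= beta. Proof. by rewrite /beta; lra. Qed.
Lemma gamma_ge1 : 1 <= gamma. Proof. by rewrite /gamma; lra. Qed.
Lemma gamma2 : 2 <= gamma ^+ 2. Proof. by rewrite /gamma; lra. Qed.
Lemma gamma3 : 3 <= gamma ^+ 3. Proof. by rewrite /gamma; lra. Qed.
Lemma gamma_beta : gamma ^+ 3 <= beta ^+ 8. Proof. by rewrite /gamma /beta; lra. Qed.

Lemma score_beta D : 100 <= (score D)%:R * beta ^+ D :> R.
Proof.
have le k s : (k <= D)%N -> 0 <= s -> 100 <= s * beta ^+ k -> 100 <= s * beta ^+ D.
  move=> kD s0 h; apply: le_trans h _; apply: ler_wpM2l => //.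
  by apply: ler_weXn2l => //; apply: beta_ge1.
rewrite /score; case: ltnP => [_|l5]; first by apply: (le 0%N) => //; lra.
case: ltnP => [_|l7]; first by apply: (le 5%N) => //; rewrite /beta; lra.
case: ltnP => [_|l8]; first by apply: (le 7%N) => //; rewrite /beta; lra.
case: ltnP => [_|l9]; first by apply: (le 8%N) => //; rewrite /beta; lra.
by apply: (le 9%N) => //; rewrite /beta; lra.
Qed.

Definition potential (f : frame) : R :=
  if f.1 then gamma ^+ nlist f.2 3 else beta ^+ mass f.2.

Lemma potential_ge1 f : 1 <= potential f.
Proof.
by rewrite /potential; case: ifP => _; apply: exprn_ege1; rewrite ?beta_ge1 ?gamma_ge1.
Qed.

Lemma potential_sub m P L : sublist P L -> potential (m, P) <= potential (m, L).
Proof.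
move=> sPL; rewrite /potential /=; case: m.
  by apply: ler_weXn2l; [exact: gamma_ge1 | exact: nlist3_sub].
by apply: ler_weXn2l; [exact: beta_ge1 | exact: mass_sub].
Qed.

Lemma kids_potential m L v :
  \sum_(f <- kids m L v) potential f =
  \sum_(c < 3 | ~~ dead (branch G L v c)) potential (m, branch G L v c).
Proof.
rewrite big_map big_filter; apply: perm_big => /=.
apply: uniq_perm; rewrite ?index_enum_uniq // => c.
by rewrite mem_index_enum mem_rev mem_colours.
Qed.

Lemma cheap_potential L v :
  cheap G L v -> \sum_(f <- kids false L v) potential f <= potential (false, L).
Proof.
rewrite kids_potential /cheap => le.
have b0 : 0 <= beta ^+ mass L by apply/exprn_ge0/(le_trans ler01 beta_ge1).
rewrite -(ler_pM2l (_ : 0 < 100)) // /potential /=.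
apply: (@le_trans _ _ ((\sum_(c < 3) weight G L v c)%:R * beta ^+ mass L)); last first.
  by apply: ler_wpM2r => //; rewrite ler_nat.
rewrite natr_sum mulr_sumr mulr_suml big_mkcond /=.
apply: ler_sum => c _; rewrite /weight; case: (dead _) => /=; first by rewrite mul0r.
have := mass_sub (@branch_sub _ G L v c).
move: (mass _) (mass L) => p l pl.
rewrite -{2}(subnK pl) exprD mulrA; apply: ler_wpM2r; last exact: score_beta.
by apply/exprn_ge0/(le_trans ler01 beta_ge1).
Qed.

(** Here [3 * mass L >= 8 * nlist L 3], and [gamma ^+ 3 <= beta ^+ 8]. *)
Lemma switch_potential L :
  (2 * nlist L 3 <= 3 * nlist L 2)%N -> potential (true, L) <= potential (false, L).
Proof.
rewrite /potential /= => le.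
have b0 : 0 <= beta by apply/(le_trans ler01 beta_ge1).
have g0 : 0 <= gamma by apply/(le_trans ler01 gamma_ge1).
rewrite -(ler_pXn2r (_ : 0 < 3)%N) ?nnegrE ?exprn_ge0 //.
rewrite -exprM mulnC exprM.
apply: (@le_trans _ _ ((beta ^+ 8) ^+ nlist L 3)).
  by apply: lerXn2r; rewrite ?nnegrE ?exprn_ge0 ?gamma_beta.
by rewrite -!exprM; apply: ler_weXn2l; [exact: beta_ge1 | rewrite /mass; lia].
Qed.

Lemma gamma_drop k n p : k%:R <= gamma ^+ p -> (p <= n)%N ->
  k%:R * gamma ^+ (n - p) <= gamma ^+ n.
Proof.
move=> kp pn; rewrite -{2}(subnKC pn) exprD; apply: ler_wpM2r => //.
by apply/exprn_ge0/(le_trans ler01 gamma_ge1).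
Qed.

(** Either at most two children that have lost two three-coloured vertices each,
    or one child, or at most three that have lost three each. *)
Lemma settle_potential L v :
  ready L v -> \sum_(f <- settle L v) potential f <= potential (true, L).
Proof.
move=> rv; rewrite /settle; case e: [seq c <- colours | mild L v c] => [|c r].
  rewrite kids_potential big_mkcond /=.
  have le c : ~~ dead (branch G L v c) -> (3 + nlist (branch G L v c) 3 <= nlist L 3)%N.
    move=> aB; have : c \notin [seq c <- colours | mild L v c] by rewrite e.
    by rewrite mem_filter mem_colours andbT /mild aB /= -ltnNge ltn_subRL -addnS addnC.
  have [n3|n3] := ltnP (nlist L 3) 3.
    rewrite big1 => [|c _]; first exact: le_trans ler01 (potential_ge1 _).
    by case: ifP => // /le /leq_trans/(_ n3).
  apply: (@le_trans _ _ (\sum_(c < 3) gamma ^+ (nlist L 3 - 3))).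
    apply: ler_sum => c _; case: ifP => [/le l|_].
      apply: ler_weXn2l; first exact: gamma_ge1.
      by rewrite leq_subRL // l.
    by apply/exprn_ge0/(le_trans ler01 gamma_ge1).
  rewrite sumr_const card_ord -mulr_natl; apply: gamma_drop => //; exact: gamma3.
have : c \in [seq c <- colours | mild L v c] by rewrite e mem_head.
rewrite mem_filter /mild /mild_kids; set P := branch G L v c => /andP[/andP[aB d2] _].
have sPL : sublist P L := @branch_sub _ _ _ _ _.
case: ifP => [/eqP d|_]; last by rewrite big_seq1; apply: potential_sub.
rewrite big_cons big_seq1 /potential /=.
have tN := card_touched sPL.
have t2 : #|touched L P| = 2%N by rewrite -d -{1}tN addnK.
have : (nlist (oppose L P) 3 + #|touched L P| <= nlist L 3)%N.
  rewrite addnC -sum1_card big_mkcond /=; apply: nlist3_drop => x.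
  rewrite ffunE; case: (boolP (x \in _)) => xt; rewrite inE in xt; last first.
    by rewrite (negPf xt).
  rewrite xt; have /andP[/eqP x3 _] := xt; rewrite x3.
  have := cardsID (P x) (L x); rewrite x3; have /setIidPr -> := sPL x.
  by have := alive_gt0 x aB; rewrite -/P; case: eqP => //; lia.
rewrite t2 => dB.
have le k : (k + 2 <= nlist L 3)%N -> gamma ^+ k <= gamma ^+ (nlist L 3 - 2).
  by move=> ?; apply: ler_weXn2l; [exact: gamma_ge1 | lia].
apply: (@le_trans _ _ (2%:R * gamma ^+ (nlist L 3 - 2))).
  by rewrite mulr_natl mulr2n; apply: lerD; apply: le; lia.
by apply: gamma_drop; [exact: gamma2 | lia].
Qed.

Lemma expand_potential m L :
  (forall v, 6 <= degree G v)%N -> settled G L -> ~~ dead L ->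
  \sum_(f <- expand m L) potential f <= potential (m, L).
Proof.
move=> deg6 sL aL; rewrite /expand.
case e: [seq v <- enum T | suits m L v] => [|v s].
  rewrite big_seq1; case: m e => // e; apply/switch_potential/(stuck_ratio sL) => // v.
  have : v \notin [seq v <- enum T | suits false L v] by rewrite e.
  by rewrite mem_filter mem_enum andbT.
have : v \in [seq v <- enum T | suits m L v] by rewrite e mem_head.
rewrite mem_filter mem_enum andbT /suits; case: m {e} => sv.
  exact: settle_potential.
exact: cheap_potential.
Qed.

End Potential.
End Search.

Section Stack.
Variables (T : finType) (G : sgraph T).
Implicit Types (L P : lists T) (m b : bool).

Local Notation frame := (bool * lists T)%type (only parsing).

(** * Depth-first traversal *)

Definition stack_step (stk : seq frame) : seq frame + bool :=
  if stk is (m, L0) :: r then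
    let L := propagate G L0 in
    if dead L then inl r
    else if nlist L 3 + nlist L 2 == 0 then inr true
    else inl (expand G m L ++ r)
  else inr false.

Inductive stack_run (H : nat) : seq frame -> nat -> bool -> Prop :=
| StackStop stk b :
    size stk <= H -> stack_step stk = inr b -> stack_run H stk 1 b
| StackNext stk stk' j b :
    size stk <= H -> stack_step stk = inl stk' -> stack_run H stk' j b ->
    stack_run H stk j.+1 b.

Section Run.
Variables (R : realFieldType) (H : nat).
Hypothesis deg6 : forall v, 6 <= degree G v.
Local Open Scope ring_scope.

(** A bound for the number of steps spent on the tree below [f]: its leaves are
    bounded by the potential and its depth by the rank. *)
Definition charge (f : frame) : R := potential R f * (rank f).+1%:R.

(** Induction on the rank.  The stack below [f] is carried along with the rest
    [j] of the computation, which starts when the tree below [f] is exhausted;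
    each level of the tree adds at most two pending frames. *)
Lemma run_frame f r j b :
  (size r + 3 * rank f + 1 <= H)%N -> stack_run H r j b ->
  exists2 j', stack_run H (f :: r) j' (solvable G f || b)
            & j'%:R <= charge f + j%:R.
Proof.
have [k] := ubnP (rank f); elim: k f r j b => // k IH [m L0] r j b rk szH run_r.
have szS : (size ((m, L0) :: r) <= H)%N by move: szH => /=; lia.
have charge1 : 1 <= charge (m, L0).
  rewrite -[1]mulr1; apply: ler_pM => //; first exact: potential_ge1.
  by rewrite ler1n.
have [nz|z] := eqVneq (stack_step ((m, L0) :: r)) (inr true).
  exists 1%N; last by apply: le_trans charge1 _; rewrite lerDl.
  apply: StackStop => //; rewrite nz; move: nz => /=; case: ifP => // aL; case: ifP => // n _.
  rewrite /solvable /= -choosable_propagate singletons_choosable ?aL //.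
  - exact: propagate_settled.
  - by move: n; rewrite addn_eq0 => /andP[_ /eqP].
  - by move: n; rewrite addn_eq0 => /andP[/eqP].
move: z => /=; set L := propagate G L0.
case: (boolP (dead L)) => [dL _|aL].
  exists j.+1; last by rewrite -addn1 natrD addrC lerD2r.
  rewrite /solvable -choosable_propagate dead_not_choosable //=.
  by apply: StackNext run_r; rewrite //= dL.
case: (boolP (nlist L 3 + nlist L 2 == 0)%N) => // nz _.
have leL : sublist L L0 by apply: propagate_sub.
have kids (fs : seq frame) : (size fs <= 3)%N ->
    {in fs, forall f, (rank f < rank (m, L0))%N} ->
    exists2 j', stack_run H (fs ++ r) j' (has (solvable G) fs || b)
              & j'%:R <= \sum_(f <- fs) charge f + j%:R.
  elim: fs => [|f fs IHf] /= sz lt; first by exists j; rewrite // big_nil add0r.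
  have [|j1 run1 le1] := IHf (ltnW sz).
    by move=> g gfs; apply: lt; rewrite inE gfs orbT.
  have ltf := lt f (mem_head _ _).
  have [||j2 run2 le2] := IH f (fs ++ r) j1 _ _ _ run1.
  - exact: leq_trans ltf _.
  - by rewrite size_cat; move: szH sz ltf; move: (rank f) (rank _) => ? ?; lia.
  exists j2; first by rewrite -orbA.
  by rewrite big_cons -addrA; apply: le_trans le2 _; rewrite lerD2l.
have rL : (rank (m, L) <= rank (m, L0))%N by rewrite leq_add2r mass_sub.
have lt : {in expand G m L, forall f, (rank f < rank (m, L0))%N}.
  by move=> f /(expand_rank nz) h; apply: leq_trans h rL.
have [j' run' le'] := kids _ (size_expand G m L) lt.
exists j'.+1.
  rewrite /solvable /= -choosable_propagate -(expand_solvable G m L).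
  by apply: StackNext run'; rewrite //= -/L (negPf aL) (negPf nz).
rewrite -addn1 natrD; apply: le_trans (lerD le' (lexx _)) _.
rewrite addrAC lerD2r /charge [X in _ <= _ * X]mulrS mulrDr mulr1 addrC.
apply: lerD; first exact: potential_ge1.
apply: (@le_trans _ _ (\sum_(f <- expand G m L) potential R f * (rank (m, L0))%:R)).
  rewrite big_seq [X in _ <= X]big_seq; apply: ler_sum => f /lt h.
  by apply: ler_wpM2l; [exact: le_trans ler01 (potential_ge1 _ _) | rewrite ler_nat].
rewrite -mulr_suml; apply: ler_wpM2r => //.
apply: le_trans (potential_sub R m leL).
by apply: expand_potential => //; apply: propagate_settled.
Qed.

Lemma run_lists L :
  (3 * rank (false, L) + 1 <= H)%N ->
  exists2 j, stack_run H [:: (false, L)] j (choosable G L)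
           & j%:R <= charge (false, L) + 1.
Proof.
move=> szH; have [|j] := @run_frame (false, L) [::] 1 false szH.
  exact: StackStop.
by rewrite orbF => ? ?; exists j.
Qed.

End Run.
End Stack.

(** * A language with arrays and bounded loops *)

(** Arrays are interleaved in the memory above an address [base], which leaves
    all of them unbounded: array [k] occupies the cells [base + 8 * j + k].
    The variables [vBase] and [vN] hold [base] and the number of rounds of every
    loop, so that the number of operations of a command depends on nothing else
    than its text and the value of [vN]. *)
Inductive expr :=
| EVar of nat
| ECst of nat
| EAdd of expr & expr
| ESub of expr & expr
| EMem of expr
| EArr of nat & expr.

Inductive cmd :=
| CSkip
| CSet of nat & expr
| CStore of nat & expr & expr
| CSeq of cmd & cmd
| CIf of expr & cmd & cmd
| CFor of nat & cmd.

Local Notation ram := Defs.mem (only parsing).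
Local Notation vBase := 1 (only parsing).
Local Notation vN := 2 (only parsing).

Definition cell (base k j : nat) := base + (8 * j + k).

Fixpoint eval (s : state) (e : expr) : nat :=
  match e with
  | EVar x => reg s x
  | ECst c => c
  | EAdd e1 e2 => eval s e1 + eval s e2
  | ESub e1 e2 => eval s e1 - eval s e2
  | EMem e => ram s (eval s e)
  | EArr k e => ram s (cell (reg s vBase) k (eval s e))
  end.

Fixpoint den (p : cmd) (s : state) : state :=
  match p with
  | CSkip => s
  | CSet x e => set_reg s x (eval s e)
  | CStore k e1 e2 =>
      set_mem s (cell (reg s vBase) k (eval s e1)) (eval s e2)
  | CSeq p q => den q (den p s)
  | CIf e p q => if eval s e == 0 then den q s else den p s
  | CFor x p =>
      set_reg (foldl (fun s k => den p (set_reg s x k)) s (iota 0 (reg s vN)))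
        x (reg s vN)
  end.

Fixpoint var_writes (p : cmd) : seq nat :=
  match p with
  | CSkip | CStore _ _ _ => [::]
  | CSet x _ => [:: x]
  | CSeq p q | CIf _ p q => var_writes p ++ var_writes q
  | CFor x p => x :: var_writes p
  end.

Fixpoint array_writes (p : cmd) : seq nat :=
  match p with
  | CSkip | CSet _ _ => [::]
  | CStore k _ _ => [:: k]
  | CSeq p q | CIf _ p q => array_writes p ++ array_writes q
  | CFor _ p => array_writes p
  end.

Fixpoint wf (p : cmd) : bool :=
  match p with
  | CSeq p q | CIf _ p q => wf p && wf q
  | CFor x p => (x \notin var_writes p) && wf p
  | _ => true
  end.

(** Such commands cannot raise a bound on the memory, which therefore holds
    throughout the unbounded main loop. *)
Fixpoint tame (p : cmd) : bool :=
  match p with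
  | CSeq p q | CIf _ p q => tame p && tame q
  | CFor _ p => tame p
  | CStore _ _ (ECst c) => c <= 1
  | CStore _ _ (EMem _) | CStore _ _ (EArr _ _) => true
  | CStore _ _ _ => false
  | _ => true
  end.

Lemma regE s x v y : reg (set_reg s x v) y = if y == x then v else reg s y.
Proof. by []. Qed.

Lemma ramE s x v y : ram (set_mem s x v) y = if y == x then v else ram s y.
Proof. by []. Qed.

Lemma den_reg p s x : x \notin var_writes p -> reg (den p s) x = reg s x.
Proof.
elim: p s => //= [y e|p IHp q IHq|e p IHp q IHq|y p IH] s.
- by rewrite inE => /negPf->.
- by rewrite mem_cat negb_or => /andP[? ?]; rewrite IHq // IHp.
- by rewrite mem_cat negb_or => /andP[? ?]; case: ifP => _; rewrite ?IHq ?IHp.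
rewrite inE negb_or => /andP[/negPf xy xp]; rewrite xy.
move: (iota _ _) => r; elim: r s => //= k r IHr s.
by rewrite IHr IH //= xy.
Qed.

Lemma den_mem p s a :
  vBase \notin var_writes p -> (forall k j, k \in array_writes p -> a != cell (reg s vBase) k j) ->
  ram (den p s) a = ram s a.
Proof.
elim: p s => //= [k e1 e2|p IHp q IHq|e p IHp q IHq|y p IH] s.
- by move=> _ /(_ k) ne; rewrite (negPf (ne _ _)) // mem_head.
- rewrite mem_cat negb_or => /andP[bp bq] ne.
  rewrite IHq ?IHp // ?den_reg // => k j kp; apply: ne; rewrite mem_cat kp ?orbT //.
- rewrite mem_cat negb_or => /andP[bp bq] ne.
  by case: ifP => _; rewrite ?IHq ?IHp // => k j kp; apply: ne; rewrite mem_cat kp ?orbT.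
rewrite inE negb_or => /andP[by_ bp] ne.
move: (iota _ _) => r; elim: r s ne => //= k r IHr s ne.
by rewrite IHr ?IH //= ?den_reg //= ?(negPf by_).
Qed.

Lemma den_tame p s M :
  0 < M -> tame p -> (forall a, ram s a <= M) -> forall a, ram (den p s) a <= M.
Proof.
move=> M0; elim: p s => //= [k e1 e2|p IHp q IHq|e p IHp q IHq|y p IH] s.
- move=> te le a; case: ifP => _; last exact: le.
  by case: e2 te => //= c c1; apply: leq_trans c1 _.
- by move=> /andP[tp tq] le; apply: IHq => //; apply: IHp.
- by move=> /andP[tp tq] le; case: ifP => _; [apply: IHq | apply: IHp].
move=> tp; move: (iota _ _) => r; elim: r s => //= k r IHr s le.
by apply: IHr; apply: IH.
Qed.

(** * Compilation and logarithmic cost *)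

(** Variable [x] lives in the even register [x.*2], and expressions are
    evaluated on a stack of odd registers. *)
Definition tmp d := d.*2.+1.

Fixpoint seqs (ps : seq prog) : prog :=
  if ps is p :: ps then Seq p (seqs ps) else Skip.

(** Three doublings multiply the index by 8. *)
Definition address d k :=
  seqs [:: Add (tmp d) (tmp d) (tmp d); Add (tmp d) (tmp d) (tmp d);
           Add (tmp d) (tmp d) (tmp d); Const (tmp d.+1) k;
           Add (tmp d) (tmp d) (tmp d.+1); Add (tmp d) vBase.*2 (tmp d)].

Fixpoint cexp (d : nat) (e : expr) : prog :=
  match e with
  | EVar x => Seq (Const (tmp d) 0) (Add (tmp d) x.*2 (tmp d))
  | ECst c => Const (tmp d) c
  | EAdd e1 e2 =>
      Seq (cexp d e1) (Seq (cexp d.+1 e2) (Add (tmp d) (tmp d) (tmp d.+1)))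
  | ESub e1 e2 =>
      Seq (cexp d e1) (Seq (cexp d.+1 e2) (Defs.Sub (tmp d) (tmp d) (tmp d.+1)))
  | EMem e => Seq (cexp d e) (Get (tmp d) (tmp d))
  | EArr k e => Seq (cexp d e) (Seq (address d k) (Get (tmp d) (tmp d)))
  end.

Definition loop_tail x :=
  seqs [:: Const (tmp 0) 1; Add x.*2 x.*2 (tmp 0); Defs.Sub (tmp 0) vN.*2 x.*2].

Fixpoint compile (p : cmd) : prog :=
  match p with
  | CSkip => Skip
  | CSet x e => Seq (cexp 0 e) (Seq (Const (tmp 1) 0) (Add x.*2 (tmp 0) (tmp 1)))
  | CStore k e1 e2 =>
      Seq (cexp 0 e1) (Seq (address 0 k) (Seq (cexp 1 e2) (Put (tmp 0) (tmp 1))))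
  | CSeq p q => Seq (compile p) (compile q)
  | CIf e p q => Seq (cexp 0 e) (If (tmp 0) (compile p) (compile q))
  | CFor x p =>
      Seq (Const x.*2 0) (Seq (Defs.Sub (tmp 0) vN.*2 x.*2)
        (While (tmp 0) (Seq (compile p) (loop_tail x))))
  end.

Definition address_ops k := k + 7.

Fixpoint eops (e : expr) : nat :=
  match e with
  | EVar x => 2
  | ECst c => c.+1
  | EAdd e1 e2 | ESub e1 e2 => eops e1 + (eops e2 + 1)
  | EMem e => eops e + 1
  | EArr k e => eops e + (address_ops k + 1)
  end.

Fixpoint ops (n : nat) (p : cmd) : nat :=
  match p with
  | CSkip => 1
  | CSet x e => eops e + 2
  | CStore k e1 e2 => eops e1 + (address_ops k + (eops e2 + 1))
  | CSeq p q => ops n p + ops n q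
  | CIf e p q => eops e + (ops n p + ops n q + 1)
  | CFor x p => 2 + (n * (ops n p + 6) + 1)
  end.

Definition fits b (s : state) :=
  (forall i, reg s i < 2 ^ b) /\ (forall a, ram s a < 2 ^ b).

(** The cost of [m] operations on words of [b] bits: as an operation lengthens
    words by at most one bit, all operands have at most [b + m] bits. *)
Definition steps b m (p : prog) (s s' : state) :=
  (exists2 t, exec p s t s' & t <= m * (2 * (b + m))) /\ fits (b + m) s'.

Lemma fits_le b b' s : b <= b' -> fits b s -> fits b' s.
Proof.
move=> le [f1 f2]; have le2 : 2 ^ b <= 2 ^ b' by rewrite leq_exp2l.
by split=> i; apply: leq_trans le2.
Qed.

Lemma steps_le b m m' p s s' : m <= m' -> steps b m p s s' -> steps b m' p s s'.
Proof.
move=> le [[t ex tm] f]; split; last by apply: fits_le f; rewrite leq_add2l.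
by exists t => //; apply: leq_trans tm _; rewrite leq_mul // leq_mul2l leq_add2l le orbT.
Qed.

Lemma bitlen_le b x : 0 < b -> x < 2 ^ b -> bitlen x <= b.
Proof.
rewrite /bitlen; case: x => [|x] b0 lt; first by rewrite trunc_log0.
by rewrite -(ltn_exp2l _ _ (isT : 1 < 2)); apply: leq_ltn_trans lt; apply: trunc_logP.
Qed.

Lemma bitlenS c : bitlen c <= c.+1.
Proof. by apply: bitlen_le => //; apply/(ltn_trans (ltnSn c))/ltn_expl. Qed.

Lemma cost_add b m1 m2 t1 t2 :
  t1 <= m1 * (2 * (b + m1)) -> t2 <= m2 * (2 * (b + m1 + m2)) ->
  t1 + t2 <= (m1 + m2) * (2 * (b + (m1 + m2))).
Proof.
move=> l1 l2; rewrite mulnDl addnA; apply: leq_add l2.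
by apply: leq_trans l1 _; rewrite leq_mul2l leq_mul2l leq_addr !orbT.
Qed.

Lemma steps_seq b m1 m2 p q s s1 s2 :
  steps b m1 p s s1 -> (fits (b + m1) s1 -> steps (b + m1) m2 q s1 s2) ->
  steps b (m1 + m2) (Seq p q) s s2.
Proof.
move=> [[t1 e1 l1] f1] /(_ f1)[[t2 e2 l2] f2]; split; last by rewrite addnA.
by exists (t1 + t2); [exact: exec_Seq e1 e2 | exact: cost_add].
Qed.

Section Atomic.
Variables (b : nat) (s : state).
Hypotheses (b0 : 0 < b) (f : fits b s).

Let pow2 : 2 ^ b <= 2 ^ (b + 1).
Proof. by rewrite leq_exp2l // leq_addr. Qed.

Let bit i : bitlen (reg s i) <= b.
Proof. by apply: bitlen_le => //; case: f. Qed.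

Let bitm a : bitlen (ram s a) <= b.
Proof. by apply: bitlen_le => //; case: f. Qed.

Let fits_reg m i x : x < 2 ^ (b + m) -> fits (b + m) (set_reg s i x).
Proof.
have [f1 f2] := fits_le (leq_addr m b) f.
by move=> lt; split=> // j /=; case: ifP.
Qed.

Lemma cost1 t1 t2 : t1 <= b -> t2 <= b -> t1 + t2 <= 1 * (2 * (b + 1)).
Proof. lia. Qed.

Lemma steps_Skip : steps b 1 Skip s s.
Proof.
split; last by apply: fits_le f; rewrite leq_addr.
by exists 1; [exact: exec_Skip | lia].
Qed.

Lemma steps_Const i c : steps b c.+1 (Const i c) s (set_reg s i c).
Proof.
split.
  exists (bitlen c); first exact: exec_Const.
  by apply: leq_trans (bitlenS c) _; rewrite leq_pmulr // muln_gt0 addnS.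
apply: fits_reg; apply: (leq_trans (ltn_expl c (isT : 1 < 2))).
by rewrite leq_exp2l // addnS leqW // leq_addl.
Qed.

Lemma steps_Add i j k :
  steps b 1 (Add i j k) s (set_reg s i (reg s j + reg s k)).
Proof.
split; first by eexists; [exact: exec_Add | exact: cost1].
by apply: fits_reg; rewrite addn1 expnS mul2n -addnn; case: f => f1 _; rewrite -addnS leq_add // ltnW.
Qed.

Lemma steps_Sub i j k :
  steps b 1 (Defs.Sub i j k) s (set_reg s i (reg s j - reg s k)).
Proof.
split; first by eexists; [exact: exec_Sub | exact: cost1].
apply: fits_reg; apply: leq_ltn_trans (leq_subr _ _) _.
by apply: leq_trans pow2; case: f.
Qed.

Lemma steps_Get i j :
  steps b 1 (Get i j) s (set_reg s i (ram s (reg s j))).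
Proof.
split; first by eexists; [exact: exec_Get | exact: cost1].
by apply: fits_reg; apply: leq_trans pow2; case: f.
Qed.

Lemma steps_Put i j :
  steps b 1 (Put i j) s (set_mem s (reg s i) (reg s j)).
Proof.
split; first by eexists; [exact: exec_Put | exact: cost1].
have [f1 f2] := fits_le (leq_addr 1 b) f.
by split=> // a /=; case: ifP.
Qed.

Lemma steps_If i m p q s' :
  steps b m (if reg s i == 0 then q else p) s s' ->
  steps b (m + 1) (If i p q) s s'.
Proof.
move=> [[t ex le] f']; split; last by apply: fits_le f'; rewrite addnA leq_addr.
exists (bitlen (reg s i) + t).
  by case: eqP ex => [e|/eqP ne]; [exact: exec_If_false | exact: exec_If_true].
rewrite addnC; apply: (cost_add le).
by apply: leq_trans (bit i) _; lia.
Qed.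

Lemma steps_While_false i p : reg s i = 0 -> steps b 1 (While i p) s s.
Proof.
move=> e; split; last by apply: fits_le f; rewrite leq_addr.
exists (bitlen (reg s i)); first exact: exec_While_false.
by apply: leq_trans (bit i) _; lia.
Qed.

Lemma steps_While_true i m1 m2 p s1 s2 :
  reg s i != 0 -> steps b m1 p s s1 ->
  steps (b + m1) m2 (While i p) s1 s2 ->
  steps b (m1 + m2 + 1) (While i p) s s2.
Proof.
move=> nz [[t1 e1 l1] _] [[t2 e2 l2] f2].
split; last by apply: fits_le f2; rewrite !addnA leq_addr.
exists (bitlen (reg s i) + t1 + t2); first exact: exec_While_true e2.
rewrite -addnA addnC; apply: cost_add; first exact: cost_add.
by apply: leq_trans (bit i) _; lia.
Qed.

End Atomic.

Definition sim (s a : state) :=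
  (forall x, reg s x.*2 = reg a x) /\ ram s =1 ram a.

Lemma tmp_even d x : (tmp d == x.*2) = false.
Proof. by apply/eqP=> /(congr1 odd); rewrite /= !odd_double. Qed.

Lemma even_tmp d x : (x.*2 == tmp d) = false.
Proof. by rewrite eq_sym tmp_even. Qed.

Lemma tmp_eq d e : (tmp d == tmp e) = (d == e).
Proof. by rewrite eqSS -!muln2 eqn_mul2r. Qed.

Lemma sim_tmp s a d x : sim s a -> sim (set_reg s (tmp d) x) a.
Proof. by move=> [s1 s2]; split=> // y /=; rewrite even_tmp. Qed.

Lemma sim_var s a x v : sim s a -> sim (set_reg s x.*2 v) (set_reg a x v).
Proof.
move=> [s1 s2]; split=> // y /=.
by rewrite -!muln2 eqn_mul2r /= muln2; case: ifP.
Qed.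

(** What the evaluation of an expression at depth [d] leaves intact. *)
Definition below d (s s' : state) :=
  [/\ forall x, reg s' x.*2 = reg s x.*2,
      forall e, e < d -> reg s' (tmp e) = reg s (tmp e) & ram s' = ram s].

Lemma below_trans d s1 s2 s3 : below d s1 s2 -> below d s2 s3 -> below d s1 s3.
Proof.
move=> [a1 a2 a3] [b1 b2 b3]; split=> [x|e ed|]; first by rewrite b1 a1.
  by rewrite b2 // a2.
by rewrite b3 a3.
Qed.

Lemma below_set d e s x : d <= e -> below d s (set_reg s (tmp e) x).
Proof.
move=> de; split=> //= [y|f fd]; first by rewrite even_tmp.
by rewrite tmp_eq; case: eqP => // fe; rewrite fe ltnNge de in fd.
Qed.

Lemma below_up d s s' : below d.+1 s s' -> below d s s'.
Proof. by move=> [b1 b2 b3]; split=> // e ed; apply: b2; apply: leqW. Qed.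

Lemma below_sim d s s' a : below d s s' -> sim s a -> sim s' a.
Proof. by move=> [b1 _ b3] [s1 s2]; split=> [x|y]; rewrite ?b1 ?b3. Qed.

Lemma address_ok d k s b :
  0 < b -> fits b s ->
  exists s', [/\ steps b (address_ops k) (address d k) s s', below d s s'
    & reg s' (tmp d) = cell (reg s vBase.*2) k (reg s (tmp d))].
Proof.
move=> b0 f; rewrite /address_ops.
rewrite (_ : k + 7 = 1 + (1 + (1 + (k.+1 + (1 + (1 + 1)))))); last by lia.
have n01 : (tmp d == tmp d.+1) = false by rewrite tmp_eq; apply/eqP; lia.
eexists; split.
- apply: steps_seq => [|f1]; first exact: steps_Add.
  apply: steps_seq => [|f2]; first by apply: (steps_Add _ f1); lia.
  apply: steps_seq => [|f3]; first by apply: (steps_Add _ f2); lia.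
  apply: steps_seq => [|f4]; first exact (steps_Const f3 _ _).
  apply: steps_seq => [|f5]; first by apply: (steps_Add _ f4); lia.
  apply: steps_seq => [|f6]; first by apply: (steps_Add _ f5); lia.
  by apply: (steps_Skip _ f6); lia.
- by do !(apply: below_trans; last by apply: below_set; lia).
by rewrite !regE !eqxx n01 !even_tmp /cell; lia.
Qed.

Lemma cexp_ok e d s a b :
  0 < b -> fits b s -> sim s a ->
  exists s', [/\ steps b (eops e) (cexp d e) s s', below d s s'
    & reg s' (tmp d) = eval a e].
Proof.
elim: e d s b => [x|c|e1 IH1 e2 IH2|e1 IH1 e2 IH2|e IH|k e IH] d s b b0 f sm.
- eexists; split.
  + apply: (@steps_seq _ 1 1) => [|f1]; first exact: steps_Const.
    by apply: (steps_Add _ f1); lia.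
  + by apply: below_trans; apply: below_set.
  by rewrite /= !eqxx even_tmp addn0; case: sm.
- eexists; split; [exact: steps_Const | exact: below_set |].
  by rewrite /= eqxx.
- have [s1 [st1 b1 v1]] := IH1 d s b b0 f sm.
  have [||s2 [st2 b2 v2]] := IH2 d.+1 s1 (b + eops e1) _ (proj2 st1) _; first by lia.
    exact: below_sim b1 sm.
  eexists; split.
  + apply: steps_seq st1 _ => f1; apply: steps_seq st2 _ => f2.
    by apply: (steps_Add _ f2); lia.
  + apply: below_trans b1 _; apply: below_trans (below_up b2) _; exact: below_set.
  by rewrite /= eqxx v2; case: b2 => _ -> //; rewrite v1.
- have [s1 [st1 b1 v1]] := IH1 d s b b0 f sm.
  have [||s2 [st2 b2 v2]] := IH2 d.+1 s1 (b + eops e1) _ (proj2 st1) _; first by lia.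
    exact: below_sim b1 sm.
  eexists; split.
  + apply: steps_seq st1 _ => f1; apply: steps_seq st2 _ => f2.
    by apply: (steps_Sub _ f2); lia.
  + apply: below_trans b1 _; apply: below_trans (below_up b2) _; exact: below_set.
  by rewrite /= eqxx v2; case: b2 => _ -> //; rewrite v1.
- have [s1 [st1 b1 v1]] := IH d s b b0 f sm.
  eexists; split.
  + by apply: steps_seq st1 _ => f1; apply: (steps_Get _ f1); lia.
  + by apply: below_trans b1 _; apply: below_set.
  by rewrite /= eqxx v1; case: (below_sim b1 sm).
have [s1 [st1 b1 v1]] := IH d s b b0 f sm.
have b1' : 0 < b + eops e by lia.
have [s2 [st2 b2 v2]] := address_ok d k b1' (proj2 st1).
eexists; split.
+ apply: steps_seq st1 _ => f1; apply: steps_seq st2 _ => f2.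
  by apply: (steps_Get _ f2); lia.
+ by apply: below_trans b1 _; apply: below_trans b2 _; apply: below_set.
rewrite /= eqxx v2 v1; have [r1 r2] := below_sim b1 sm.
by have [_ ->] := below_sim b2 (conj r1 r2); rewrite r1.
Qed.

(** The states of the machine and of the language agree on variables and
    memory, so that the command determines the result up to the temporaries.
    In a loop, the induction is on the number of rounds left, with [c0] the
    state of the language before the loop variable is set. *)
Lemma compile_ok p s a b n :
  0 < b -> wf p -> vN \notin var_writes p -> reg a vN = n -> fits b s -> sim s a ->
  exists s', steps b (ops n p) (compile p) s s' /\ sim s' (den p a).
Proof.
elim: p s a b => [|x e|k e1 e2|p IHp q IHq|e p IHp q IHq|x p IH] s a b b0.
- by move=> _ _ _ f sm; exists s; split=> //; apply: steps_Skip.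
- move=> _ _ _ f sm; have [s1 [st1 b1 v1]] := cexp_ok e 0 b0 f sm.
  eexists; split.
    apply: (steps_seq st1) => f1; apply: (@steps_seq _ 1 1) => [|f2].
      exact (steps_Const f1 _ _).
    by apply: (steps_Add _ f2); lia.
  rewrite /= v1 addn0; apply: sim_var; apply: sim_tmp; exact: below_sim b1 sm.
- move=> _ _ _ f sm; have [s1 [st1 b1 v1]] := cexp_ok e1 0 b0 f sm.
  have p1 : 0 < b + eops e1 by lia.
  have [s2 [st2 b2 v2]] := address_ok 0 k p1 (proj2 st1).
  have sm1 := below_sim b1 sm; have sm2 := below_sim b2 sm1.
  have p2 : 0 < b + eops e1 + address_ops k by lia.
  have [s3 [st3 b3 v3]] := cexp_ok e2 1 p2 (proj2 st2) sm2.
  eexists; split.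
    apply: (steps_seq st1) => _; apply: (steps_seq st2) => _.
    by apply: (steps_seq st3) => f3; apply: (steps_Put _ f3); lia.
  have [r1 r2] := below_sim b3 sm2; split=> // y.
  rewrite /= r2 v3; case: b3 => _ -> // _; rewrite v2 v1.
  by case: sm1 => ->.
- move=> /= /andP[wp wq]; rewrite mem_cat negb_or => /andP[np nq] an f sm.
  have [s1 [st1 sm1]] := IHp s a b b0 wp np an f sm.
  have [||s2 [st2 sm2]] := IHq s1 _ (b + ops n p) _ wq nq _ (proj2 st1) sm1; first by lia.
    by rewrite den_reg.
  by exists s2; split=> //; apply: steps_seq st1 _.
- move=> /= /andP[wp wq]; rewrite mem_cat negb_or => /andP[np nq] an f sm.
  have [s1 [st1 b1 v1]] := cexp_ok e 0 b0 f sm.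
  have sm1 := below_sim b1 sm; have b0' : 0 < b + eops e by lia.
  have [s2 [st2 sm2]] : exists s2,
      steps (b + eops e) (ops n p + ops n q)
        (if reg s1 (tmp 0) == 0 then compile q else compile p) s1 s2
      /\ sim s2 (if eval a e == 0 then den q a else den p a).
    rewrite v1; case: eqP => _.
      have [s2 [st2 sm2]] := IHq s1 a _ b0' wq nq an (proj2 st1) sm1.
      by exists s2; split=> //; apply: steps_le st2; rewrite leq_addl.
    have [s2 [st2 sm2]] := IHp s1 a _ b0' wp np an (proj2 st1) sm1.
    by exists s2; split=> //; apply: steps_le st2; rewrite leq_addr.
  exists s2; split=> //; apply: (steps_seq st1) => f1.
  exact: (steps_If b0' f1 st2).
move=> /= /andP[xp wp]; rewrite inE negb_or => /andP[nx np] an f sm.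
have loop r k t c c0 : 0 < c -> fits c t -> sim t (set_reg c0 x k) ->
    reg c0 vN = n -> k + r = n -> reg t (tmp 0) = r ->
    exists t', steps c (r * (ops n p + 6) + 1)
        (While (tmp 0) (Seq (compile p) (loop_tail x))) t t'
      /\ sim t' (set_reg (foldl (fun s k => den p (set_reg s x k)) c0 (iota k r)) x n).
  elim: r k t c c0 => [|r IHr] k t c c0 c_gt0 ft smt c0n kr tr.
    exists t; split; first exact: steps_While_false.
    by rewrite -kr addn0.
  have [|t1 [st1 sm1]] := IH t (set_reg c0 x k) c c_gt0 wp np _ ft smt.
    by rewrite /= (negPf nx).
  set c1 := den p _ in sm1.
  have c1x : reg c1 x = k by rewrite /c1 den_reg //= eqxx.
  have c1n : reg c1 vN = n by rewrite /c1 den_reg //= (negPf nx).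
  pose w := set_reg t1 (tmp 0) 1.
  pose u := set_reg w x.*2 (reg w x.*2 + reg w (tmp 0)).
  pose t2 := set_reg u (tmp 0) (reg u vN.*2 - reg u x.*2).
  have simu : sim u (set_reg c1 x k.+1).
    rewrite /u (_ : _ + _ = k.+1); first exact/sim_var/sim_tmp.
    by rewrite !regE eqxx even_tmp (proj1 sm1) c1x addn1.
  have t2r : reg t2 (tmp 0) = r.
    rewrite regE eqxx (proj1 simu) (proj1 simu) !regE eqxx (negPf nx) c1n.
    by rewrite -kr addnS -addSn addKn.
  have st2 : steps c (ops n p + 5) (Seq (compile p) (loop_tail x)) t t2.
    apply: (steps_seq st1) => f1.
    apply: (@steps_seq _ 2 3) => [|f2]; first exact (steps_Const f1 _ _).
    apply: (@steps_seq _ 1 2) => [|f3]; first by apply: (steps_Add _ f2); lia.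
    apply: (@steps_seq _ 1 1) => [|f4]; first by apply: (steps_Sub _ f3); lia.
    by apply: (steps_Skip _ f4); lia.
  have [|||t3 [st3 sm3]] := IHr k.+1 t2 (c + (ops n p + 5)) c1 _ (proj2 st2) _ c1n _ t2r.
  - by lia.
  - exact: sim_tmp.
  - by lia.
  exists t3; split=> //.
  rewrite (_ : _ + 1 = (ops n p + 5) + (r * (ops n p + 6) + 1) + 1); last by rewrite mulSn; lia.
  by apply: steps_While_true st3 => //; rewrite tr.
have b2 : 0 < b + 1 + 1 by lia.
have st1 := steps_Const f x.*2 0.
pose u := set_reg s x.*2 0.
have simu : sim u (set_reg a x 0) by apply: sim_var.
have st2 : steps (b + 1) 1 (Defs.Sub (tmp 0) vN.*2 x.*2) u
             (set_reg u (tmp 0) (reg u vN.*2 - reg u x.*2)).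
  by apply: (steps_Sub _ (proj2 st1)); lia.
have [|||s3 [st3 sm3]] := loop n 0 _ _ a b2 (proj2 st2) _ an.
- exact: sim_tmp.
- by [].
- by rewrite regE eqxx !(proj1 simu) !regE eqxx (negPf nx) an subn0.
exists s3; rewrite an; split=> //.
apply: (@steps_seq _ 1 (1 + _) _ _ _ _ _ st1) => _.
by apply: (@steps_seq _ 1 _ _ _ _ _ _ st2).
Qed.

Fixpoint reg_writes (p : prog) : seq nat :=
  match p with
  | Const i _ | Add i _ _ | Defs.Sub i _ _ | Get i _ => [:: i]
  | Seq p q | If _ p q => reg_writes p ++ reg_writes q
  | While _ p => reg_writes p
  | _ => [::]
  end.

Lemma exec_reg p s t s' i : exec p s t s' -> i \notin reg_writes p -> reg s' i = reg s i.
Proof.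
elim=> //= {p s t s'}.
- by move=> s j c; rewrite inE => /negPf->.
- by move=> s j k l; rewrite inE => /negPf->.
- by move=> s j k l; rewrite inE => /negPf->.
- by move=> s j k; rewrite inE => /negPf->.
- by move=> p q s s1 s2 t t' _ IH1 _ IH2; rewrite mem_cat negb_or => /andP[/IH1<- /IH2].
- by move=> j p q s t s' _ _ IH; rewrite mem_cat negb_or => /andP[/IH].
- by move=> j p q s t s' _ _ IH; rewrite mem_cat negb_or => /andP[_ /IH].
by move=> j p s s1 s2 t t' _ _ IH1 _ IH2 np; rewrite IH2 ?IH1.
Qed.

Definition poly_bounded (f : nat -> nat) :=
  exists C k, forall n, f n <= C * n.+1 ^ k.

Lemma poly_const c : poly_bounded (fun=> c).
Proof. by exists c, 0 => n; rewrite expn0 muln1. Qed.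

Lemma poly_id : poly_bounded id.
Proof. by exists 1, 1 => n; rewrite mul1n. Qed.

Lemma poly_add f g :
  poly_bounded f -> poly_bounded g -> poly_bounded (fun n => f n + g n).
Proof.
move=> [C [k le]] [C' [k' le']]; exists (C + C'), (k + k') => n.
rewrite mulnDl; apply: leq_add.
  by apply: leq_trans (le n) _; rewrite leq_mul2l leq_pexp2l ?orbT // leq_addr.
by apply: leq_trans (le' n) _; rewrite leq_mul2l leq_pexp2l ?orbT // leq_addl.
Qed.

Lemma poly_mul f g :
  poly_bounded f -> poly_bounded g -> poly_bounded (fun n => f n * g n).
Proof.
move=> [C [k le]] [C' [k' le']]; exists (C * C'), (k + k') => n.
by rewrite expnD mulnACA leq_mul.
Qed.

Lemma poly_ops p : poly_bounded (ops^~ p).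
Proof.
elim: p => [|x e|k e1 e2|p IHp q IHq|e p IHp q IHq|x p IHp]; try exact: poly_const.
- exact: poly_add IHp IHq.
- exact: poly_add (poly_const _) (poly_add (poly_add IHp IHq) (poly_const _)).
exact: poly_add (poly_const _) (poly_add (poly_mul poly_id (poly_add IHp (poly_const _)))
  (poly_const _)).
Qed.

(** * The program *)

Local Notation "p ;; q" := (CSeq p q) (at level 60, right associativity).

(* The variables.  vV, vU, vW, vR and vI count the rounds of loops.  vCnt and
   its two successors hold the numbers of lists of size 3, 2 and 0 among the
   current lists, and vCntB c the same for the branch on the colour c. *)
Local Notation vAns := 0 (only parsing).
Local Notation vSp := 3 (only parsing).
Local Notation vFrame := 4 (only parsing).
Local Notation vRun := 5 (only parsing).
Local Notation vMode := 6 (only parsing).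
Local Notation vDone := 7 (only parsing).
Local Notation vV := 8 (only parsing).
Local Notation vU := 9 (only parsing).
Local Notation vW := 10 (only parsing).
Local Notation vR := 11 (only parsing).
Local Notation vI := 12 (only parsing).
Local Notation vSum := 13 (only parsing).
Local Notation vCnt := 14 (only parsing).
Local Notation vCntB c := (17 + 3 * c) (only parsing).
Local Notation vD := 26 (only parsing).

(* The arrays: the current lists, their three branches, the stack, the opposed
   lists, and the multiples of the number of vertices, which locate the rows of
   the adjacency matrix.  Lists are stored as three bits per vertex. *)
Local Notation aL := 0 (only parsing).
Local Notation aB c := (1 + c) (only parsing).
Local Notation aS := 4 (only parsing).
Local Notation aO := 5 (only parsing).
Local Notation aRow := 7 (only parsing).

Definition epos x c :=
  EAdd (EAdd (EVar x) (EAdd (EVar x) (EVar x))) (ECst c).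

Definition thrice f := f 0 ;; f 1 ;; f 2.

Definition esize k x :=
  EAdd (EAdd (EArr k (epos x 0)) (EArr k (epos x 1))) (EArr k (epos x 2)).

Definition triple e := EAdd e (EAdd e e).

Definition pfill k off src :=
  CFor vI (thrice (fun c => CStore k (EAdd off (epos vI c)) (src c))).

Definition pcopy k k' := pfill k (ECst 0) (fun c => EArr k' (epos vI c)).

Definition pclear k x c := CStore k (epos x c) (ECst 0).

Definition premove k :=
  CIf (EMem (EAdd (EAdd (ECst 1) (EArr aRow (EVar vU))) (EVar vW)))
    (CIf (esize k vU)
      (CIf (ESub (esize k vU) (ECst 1)) CSkip
        (thrice (fun c => CIf (EArr k (epos vU c)) (pclear k vW c) CSkip)))
      CSkip)
    CSkip.

Definition pround k := CFor vU (CFor vW (premove k)).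

Definition pprop k := CFor vR (pround k ;; pround k ;; pround k).

Definition incr x := CSet x (EAdd (EVar x) (ECst 1)).

Definition pcount k x :=
  CSet x (ECst 0) ;; CSet x.+1 (ECst 0) ;; CSet x.+2 (ECst 0) ;;
  CFor vI
    (CIf (esize k vI)
      (CIf (ESub (esize k vI) (ECst 1))
        (CIf (ESub (esize k vI) (ECst 2)) (incr x) (incr x.+1))
        CSkip)
      (incr x.+2)).

Definition prestrict k c :=
  thrice (fun d => if d == c then CSkip else pclear k vV d).

Definition pbranch c :=
  pcopy (aB c) aL ;;
  prestrict (aB c) c ;;
  pprop (aB c) ;;
  pcount (aB c) (vCntB c).

(** A frame consists of the bits of its lists followed by its flag. *)
Definition ppush k m :=
  pfill aS (EVar vSp) (fun c => EArr k (epos vI c)) ;;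
  CStore aS (EAdd (EVar vSp) (triple (EVar vN))) (ECst m) ;;
  CSet vSp (EAdd (EVar vSp) (EVar vFrame)).

Definition ppush_alive m c := CIf (EVar (vCntB c).+2) CSkip (ppush (aB c) m).

Definition ppush_all m := thrice (ppush_alive m).

Definition emass x := EAdd (EAdd (EVar x) (EVar x)) (EVar x.+1).

Definition padd c := CSet vSum (EAdd (EVar vSum) (ECst c)).

(** The cascade computes [score] by comparing the drop of the mass with the
    thresholds 9, 8, 7 and 5. *)
Definition pweight c :=
  CIf (EVar (vCntB c).+2) CSkip
    (CSet vD (ESub (emass vCnt) (emass (vCntB c))) ;;
     CIf (ESub (EVar vD) (ECst 8)) (padd 29)
    (CIf (ESub (EVar vD) (ECst 7)) (padd 33)
    (CIf (ESub (EVar vD) (ECst 6)) (padd 38)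
    (CIf (ESub (EVar vD) (ECst 4)) (padd 50) (padd 101))))).

Definition pcheap :=
  CSet vSum (ECst 0) ;; thrice pweight ;;
  CIf (ESub (EVar vSum) (ECst 100)) CSkip
    (ppush_all 0 ;; CSet vDone (ECst 1)).

Definition poppose c :=
  pcopy aO aL ;;
  CFor vI
    (CIf (ESub (esize aL vI) (ECst 2))
      (CIf (ESub (ECst 3) (esize (aB c) vI))
        (thrice (fun d => CIf (EArr (aB c) (epos vI d)) (pclear aO vI d) CSkip))
        CSkip)
      CSkip).

Definition edrop c := ESub (EVar vCnt) (EVar (vCntB c)).

Definition pmild c rest :=
  CIf (EAdd (EVar (vCntB c).+2) (ESub (edrop c) (ECst 2))) rest
    (ppush (aB c) 1 ;;
     CIf (ESub (edrop c) (ECst 1)) (poppose c ;; ppush aO 1) CSkip).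

(** The condition is nonzero if and only if the current vertex is [ready]:
    subtracting twice from 1 tests whether there are three-coloured vertices. *)
Definition pready :=
  CIf (ESub (ESub (esize aL vV) (ECst 1))
            (ESub (ECst 1) (ESub (ECst 1) (EVar vCnt))))
    (pmild 0 (pmild 1 (pmild 2 (ppush_all 1))) ;; CSet vDone (ECst 1))
    CSkip.

Definition ptry :=
  CIf (EVar vDone) CSkip
    (thrice pbranch ;; CIf (EVar vMode) pready pcheap).

Definition pexpand :=
  CSet vDone (ECst 0) ;; CFor vV ptry ;; CIf (EVar vDone) CSkip (ppush aL 1).

Definition ppop :=
  CSet vSp (ESub (EVar vSp) (EVar vFrame)) ;;
  pfill aL (ECst 0) (fun c => EArr aS (EAdd (EVar vSp) (epos vI c))) ;;
  CSet vMode (EArr aS (EAdd (EVar vSp) (triple (EVar vN)))).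

Definition pstop := CSet vRun (ECst 0).

Definition pstep :=
  CIf (EVar vSp)
    (ppop ;; pprop aL ;; pcount aL vCnt ;;
     CIf (EVar vCnt.+2) CSkip
       (CIf (EAdd (EVar vCnt) (EVar vCnt.+1)) pexpand
          (CSet vAns (ECst 1) ;; pstop)))
    pstop.

(** * What the commands compute *)

Section Loops.
Variables (T : finType) (G : sgraph T).
Implicit Types (L P : lists T) (u v w : T) (s : state).

Local Notation n := #|T| (only parsing).

Definition idx v := index v (enum T).

Lemma idx_lt v : idx v < n.
Proof. by rewrite /idx cardE index_mem mem_enum. Qed.

Lemma idx_inj : injective idx.
Proof.
move=> u v e; have mu := mem_enum T.
by rewrite -[u](@nth_index _ u _ (enum T)) ?mem_enum // -/(idx u) e nth_index ?mem_enum.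
Qed.

Lemma iota_idx : iota 0 n = map idx (enum T).
Proof.
have sz : size (enum T) = n by rewrite -cardT.
apply: (@eq_from_nth _ 0) => [|i]; rewrite size_iota; first by rewrite size_map sz.
move=> lt.
have [x0 _] : exists x : T, true.
  by case/card_gt0P: (leq_ltn_trans (leq0n _) lt) => x; exists x.
rewrite nth_iota // (nth_map x0) ?sz // /idx index_uniq ?sz //.
exact: enum_uniq.
Qed.

Definition input_size := 1 + n * n + 3 * n.

Local Notation base := input_size (only parsing).

Definition pos v (c : nat) := idx v + (idx v + idx v) + c.

Lemma pos_inj u v (c d : 'I_3) : (pos u c == pos v d) = (u == v) && (c == d).
Proof.
apply/eqP/andP => [|[/eqP-> /eqP->] //]; rewrite /pos => e.
have lc := ltn_ord c; have ld := ltn_ord d.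
split; apply/eqP; first by apply: idx_inj; lia.
by apply: val_inj => /=; lia.
Qed.

Lemma pos_lt v (c : 'I_3) : pos v c < 3 * n.
Proof. by have := ltn_ord c; have := idx_lt v; rewrite /pos; lia. Qed.

Lemma cell_eq k j k' j' : k < 8 -> k' < 8 ->
  (cell base k j == cell base k' j') = (k == k') && (j == j').
Proof.
move=> lk lk'; apply/eqP/andP => [|[/eqP-> /eqP->] //]; rewrite /cell => e.
by split; apply/eqP; lia.
Qed.

(** What holds before and after every command of the main loop. *)
Record layout s : Prop := Layout {
  layout_base : reg s vBase = base;
  layout_n : reg s vN = n;
  layout_frame : reg s vFrame = 3 * n + 1;
  layout_adj u v : ram s (1 + idx u * n + idx v) = G u v;
  layout_row u : ram s (cell base aRow (idx u)) = idx u * n }.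

Lemma adj_lt u v : 1 + idx u * n + idx v < base.
Proof.
have lu := idx_lt u; have lv := idx_lt v; rewrite /input_size.
have : idx u * n + n <= n * n by rewrite addnC -mulSn leq_mul2r lu orbT.
lia.
Qed.

(** A syntactic condition for preserving the layout. *)
Definition nice p :=
  [&& vBase \notin var_writes p, vN \notin var_writes p,
      vFrame \notin var_writes p & all (ltn^~ 7) (array_writes p)].

Lemma den_input p s a : nice p -> layout s -> a < base -> ram (den p s) a = ram s a.
Proof.
move=> /and4P[p1 _ _ _] e lt; apply: den_mem => // k j _.
by rewrite (layout_base e) neq_ltn (leq_trans lt) // /cell leq_addr.
Qed.

Lemma den_array p s k j : nice p -> layout s -> k < 8 -> k \notin array_writes p ->
  ram (den p s) (cell base k j) = ram s (cell base k j).
Proof.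
move=> /and4P[p1 _ _ /allP lt] e k8 kp; apply: den_mem => // k' j' k'p.
rewrite (layout_base e) cell_eq // ?(leq_trans (lt _ k'p)) //.
by apply: contra kp => /andP[/eqP-> _].
Qed.

Lemma layout_den p s : nice p -> layout s -> layout (den p s).
Proof.
move=> np e; have /and4P[p1 p2 p3 lt] := np; split; rewrite ?den_reg //; try by case: e.
  by move=> u v; rewrite den_input ?adj_lt //; case: e.
move=> u; rewrite den_array //; first by case: e.
by apply: contraL lt => i7; apply/negP=> /allP/(_ _ i7).
Qed.

Lemma layout_set s x i : x != vBase -> x != vN -> x != vFrame -> layout s -> layout (set_reg s x i).
Proof.
by move=> n1 n2 n4 [e1 e2 e3 e4 e5]; split=> //; rewrite regE eq_sym ifN.
Qed.

(** Lists that are being changed bit by bit are described by predicates. *)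
Definition repf s k (M : T -> 'I_3 -> bool) :=
  forall v (c : 'I_3), ram s (cell base k (pos v c)) = M v c.

Definition rep s k L := repf s k (fun v c => c \in L v).

Lemma repf_den p s k M : nice p -> layout s -> k < 8 -> k \notin array_writes p ->
  repf s k M -> repf (den p s) k M.
Proof. by move=> np e k8 kp r v c; rewrite den_array. Qed.

Lemma rep_den p s k L : nice p -> layout s -> k < 8 -> k \notin array_writes p ->
  rep s k L -> rep (den p s) k L.
Proof. exact: repf_den. Qed.

Lemma repf_ext s k M M' : (forall v c, M v c = M' v c) -> repf s k M -> repf s k M'.
Proof. by move=> e r v c; rewrite r e. Qed.

Fixpoint stack_rep s (stk : seq (bool * lists T)) : Prop :=
  if stk is (m, L) :: r then
    let o := size r * (3 * n + 1) in
    [/\ forall v (c : 'I_3), ram s (cell base aS (o + pos v c)) = (c \in L v),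
        ram s (cell base aS (o + 3 * n)) = m & stack_rep s r]
  else True.

Definition stack_ok s stk :=
  reg s vSp = size stk * (3 * n + 1) /\ stack_rep s stk.

Lemma stack_rep_ext s s' stk :
  (forall j, j < size stk * (3 * n + 1) ->
     ram s' (cell base aS j) = ram s (cell base aS j)) ->
  stack_rep s stk -> stack_rep s' stk.
Proof.
elim: stk => // -[m L] r IH /= e; rewrite mulSn in e.
move: (size r * _) e IH => o e IH [r1 r2 r3].
split; first by move=> v c; rewrite e // addnC ltn_add2r addn1 ltnS ltnW ?pos_lt.
  by rewrite e // addnC ltn_add2r addn1.
by apply: IH r3 => j lt; apply/e/ltn_addl.
Qed.

Lemma stack_den p s stk :
  nice p -> layout s -> vSp \notin var_writes p -> aS \notin array_writes p ->
  stack_ok s stk -> stack_ok (den p s) stk.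
Proof.
move=> np e n3 n4 [s1 s2]; split; first by rewrite den_reg.
by apply: stack_rep_ext s2 => j _; apply: den_array.
Qed.

(** * Loops *)

(** Loops over the vertices perform the folds of the abstract algorithm: [R]
    relates the machine to the accumulator. *)
Lemma for_sim (X : Type) (R : state -> X -> Prop) (g : X -> T -> X) x p s y :
  reg s vN = n ->
  (forall s y v, R s y -> R (den p (set_reg s x (idx v))) (g y v)) ->
  (forall s y i, R s y -> R (set_reg s x i) y) ->
  R s y -> R (den (CFor x p) s) (foldl g y (enum T)).
Proof.
move=> sn step out r; rewrite /= sn; apply: out; rewrite iota_idx.
by elim: (enum T) s y {sn} r => //= v r IH s y Rsy; apply: IH; apply: step.
Qed.

Lemma foldl_rcons (A : Type) (y r : seq A) : foldl rcons y r = y ++ r.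
Proof. by elim: r y => [|a r IH] y /=; rewrite ?cats0 // IH cat_rcons. Qed.

Lemma for_enum (R : state -> seq T -> Prop) x p s :
  reg s vN = n ->
  (forall s ys v, R s ys -> R (den p (set_reg s x (idx v))) (rcons ys v)) ->
  (forall s ys i, R s ys -> R (set_reg s x i) ys) ->
  R s [::] -> R (den (CFor x p) s) (enum T).
Proof.
move=> sn step out r; rewrite -[enum T]cat0s -foldl_rcons; exact: for_sim.
Qed.

Lemma den_thrice f s : den (thrice f) s = foldl (fun s c => den (f (nat_of_ord c)) s) s colours.
Proof. by []. Qed.

(** The states that occur while array [k] is being filled. *)
Definition agree_off k s s' :=
  (forall x, x != vI -> reg s' x = reg s x) /\
  (forall a, (forall j, a != cell base k j) -> ram s' a = ram s a).

(** The source may depend on everything but the array that is filled, and it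
    is therefore evaluated in arbitrary states of this kind.  The cells below the
    offset survive, which protects the lower part of the stack. *)
Lemma fill_spec k off (src : nat -> expr) s o (val : T -> 'I_3 -> nat) :
  k < 8 -> layout s ->
  (forall s', agree_off k s s' -> eval s' off = o) ->
  (forall s' v (c : 'I_3), agree_off k s s' -> reg s' vI = idx v ->
     eval s' (src c) = val v c) ->
  let s' := den (pfill k off src) s in
  (forall v (c : 'I_3), ram s' (cell base k (o + pos v c)) = val v c) /\
  (forall j, j < o -> ram s' (cell base k j) = ram s (cell base k j)).
Proof.
move=> k8 e offE srcE.
pose R s' (ys : seq (T * 'I_3)) := [/\ agree_off k s s',
  forall y, y \in ys -> ram s' (cell base k (o + pos y.1 y.2)) = val y.1 y.2 &
  forall j, j < o -> ram s' (cell base k j) = ram s (cell base k j)].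
pose g ys v := foldl (fun ys (c : 'I_3) => rcons ys (v, c)) ys colours.
have [_ r2 r3] : R (den (pfill k off src) s) (foldl g [::] (enum T)).
  apply: for_sim (layout_n e) _ _ _ => [s1 ys v Rs|s1 ys i [[a1 a2] r2 r3]|].
  - have : R (set_reg s1 vI (idx v)) ys /\ reg (set_reg s1 vI (idx v)) vI = idx v.
      split=> //; case: Rs => [[a1 a2] r2 r3]; split=> //; split=> // x nx.
      by rewrite regE (negPf nx) a1.
    rewrite den_thrice /g {Rs}; move: (set_reg s1 _ _) => s2.
    elim: colours ys s2 {s1} => [|c cs IH] ys s1 /=; first by case.
    move=> [[[a1 a2] r2 r3] s1I]; apply: IH.
    have ag : agree_off k s s1 by [].
    rewrite (offE _ ag) (srcE _ _ c ag s1I) s1I (a1 vBase) // (layout_base e).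
    rewrite -/(pos v c); split=> //; split; first split=> // a na.
    + by rewrite ramE (negPf (na _)) a2.
    + move=> [w d]; rewrite mem_rcons inE ramE cell_eq // eqxx eqn_add2l pos_inj /=.
      by rewrite -xpair_eqE; case: eqP => [[-> ->]|] //= _; apply: (r2 (w, d)).
    + move=> j lt; rewrite ramE cell_eq // eqxx /= ifN ?r3 //.
      by rewrite neq_ltn (leq_trans lt) // leq_addr.
  - split=> //; split=> // x nx; by rewrite regE (negPf nx) a1.
  - by split.
split=> // v c; apply: (r2 (v, c)).
have gP ys r : (v, c) \in ys \/ v \in r -> (v, c) \in foldl g ys r.
  elim: r ys => [|w r IH] ys /=; first by case.
  case=> [vc|]; first by apply: IH; left; rewrite /g /= !(mem_rcons, inE) vc !orbT.
  rewrite inE => /orP[/eqP<-|vr]; apply: IH; [left | by right].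
  rewrite /g /= !(mem_rcons, inE) !xpair_eqE eqxx /=.
  by have := mem_colours c; rewrite !inE => /or3P[]->; rewrite ?orbT.
by apply: gP; right; rewrite mem_enum.
Qed.

Lemma agree_array k k' s s' j : agree_off k s s' -> k < 8 -> k' < 8 -> k' != k ->
  ram s' (cell base k' j) = ram s (cell base k' j).
Proof. by move=> [_ a2] k8 k8' ne; apply: a2 => j'; rewrite cell_eq // (negPf ne). Qed.

Lemma copy_spec k k' s L : k < 8 -> k' < 8 -> k' != k -> layout s ->
  rep s k' L -> rep (den (pcopy k k') s) k L.
Proof.
move=> k8 k8' ne e r v c.
have [//|s1 w d ag sI|h _] := @fill_spec k (ECst 0) (fun c => EArr k' (epos vI c)) s 0
  (fun v c => c \in L v) k8 e.
  rewrite /= -/(epos vI d) (proj1 ag) // (layout_base e) sI -/(pos w d).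
  by rewrite (agree_array _ ag) ?r.
exact: h.
Qed.

Lemma den_if e p q s :
  den (CIf e p q) s = if eval s e == 0 then den q s else den p s.
Proof. by []. Qed.

Lemma den_seq p q s : den (p ;; q) s = den q (den p s).
Proof. by []. Qed.

Lemma eval_sub s e1 e2 : eval s (ESub e1 e2) = eval s e1 - eval s e2.
Proof. by []. Qed.

Lemma clear_spec s k M x v (c : 'I_3) (b : bool) e :
  k < 7 -> layout s -> repf s k M -> reg s x = idx v -> eval s e = b ->
  repf (den (CIf e (pclear k x c) CSkip) s) k
    (fun u d => M u d && ~~ [&& b, u == v & d == c]).
Proof.
move=> k7 en r sx ev u d; rewrite /= ev; case: b {ev} => /=; last by rewrite andbT r.
rewrite sx (layout_base en) -/(pos v c) (cell_eq _ _ (ltnW k7) (ltnW k7)) eqxx pos_inj.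
by case: ((u == v) && _); rewrite ?andbF ?andbT ?r.
Qed.

Lemma sum_colours (F : 'I_3 -> nat) :
  \sum_(c < 3) F c =
  F (@Ordinal 3 0 isT) + F (@Ordinal 3 1 isT) + F (@Ordinal 3 2 isT).
Proof.
rewrite !big_ord_recl big_ord0 addn0 addnA.
by congr (F _ + F _ + F _); apply/eqP.
Qed.

Lemma eval_size s k x v L : layout s -> rep s k L -> reg s x = idx v ->
  eval s (esize k x) = #|L v|.
Proof.
move=> e r sx; rewrite -sum_mem sum_colours /= sx (layout_base e).
have := r v (@Ordinal 3 0 isT); have := r v (@Ordinal 3 1 isT).
by have := r v (@Ordinal 3 2 isT); rewrite /pos /= => -> -> ->.
Qed.

Lemma remove_spec s k u v L : k < 7 -> layout s -> rep s k L ->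
  reg s vU = idx u -> reg s vW = idx v ->
  rep (den (premove k) s) k (remove G L u v).
Proof.
move=> k7 e r su sv; rewrite /premove /remove.
have size1 : eval s (esize k vU) = #|L u| := eval_size e r su.
have adjE : eval s (EMem (EAdd (EAdd (ECst 1) (EArr aRow (EVar vU))) (EVar vW))) = G u v.
  by rewrite /= su sv (layout_base e) (layout_row e) (layout_adj e).
rewrite den_if adjE; case Guv: (G u v); last by [].
rewrite den_if size1; case e0: (#|L u| == 0); first by rewrite (eqP e0).
rewrite den_if eval_sub size1 [eval s _]/=.
case e1: (#|L u| - 1 == 0); last by rewrite ifN //; apply: contraFneq e1 => ->.
have -> /= : #|L u| == 1 by move: e0 e1; case: #|L u| => [|[|]].
have uv : u == v = false by apply: contraTF Guv => /eqP->; rewrite adj_irrefl.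
have step s1 M (c : 'I_3) : (forall d, M u d = (d \in L u)) ->
    layout s1 /\ repf s1 k M /\ reg s1 vU = idx u /\ reg s1 vW = idx v ->
    let s2 := den (CIf (EArr k (epos vU c)) (pclear k vW c) CSkip) s1 in
    layout s2 /\ repf s2 k (fun x d => M x d && ~~ [&& c \in L u, x == v & d == c]) /\
    reg s2 vU = idx u /\ reg s2 vW = idx v.
  move=> Mu [en1 [r1 [u1 v1]]]; split.
    by apply: layout_den => //; rewrite /nice /= k7.
  split; last by rewrite !den_reg.
  by apply: clear_spec => //; rewrite -Mu -r1 /= u1 (layout_base en1).
have Mu M c : (forall d, M u d = (d \in L u)) ->
   forall d, M u d && ~~ [&& c \in L u, u == v & d == c] = (d \in L u).
  by move=> h d; rewrite h uv !andbF andbT.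
pose c0 := @Ordinal 3 0 isT; pose c1 := @Ordinal 3 1 isT; pose c2 := @Ordinal 3 2 isT.
pose M0 v (c : 'I_3) := c \in L v; have M0u d : M0 u d = (d \in L u) by [].
have h0 := step s M0 c0 M0u (conj e (conj r (conj su sv))).
have h1 := step _ _ c1 (Mu M0 c0 M0u) h0.
pose M1 x d := M0 x d && ~~ [&& c0 \in L u, x == v & d == c0].
have h2 := step _ _ c2 (Mu M1 c1 (Mu M0 c0 M0u)) h1.
case: h2 => _ [+ _]; apply: repf_ext => x d; rewrite ffunE.
have [->|_] /= := eqVneq x v; last by rewrite !andbF !andbT.
have := mem_colours d; rewrite !inE => /or3P[]/eqP->;
  by rewrite !eqxx /= ?andbF ?andbT /= ?andbT andbC.
Qed.

End Loops.

(** * Propagating and branching *)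

Section Commands.
Variables (T : finType) (G : sgraph T).
Implicit Types (L P : lists T) (u v w : T) (s : state) (m : bool).

Local Notation n := #|T| (only parsing).
Local Notation base := (input_size T) (only parsing).
Local Notation frame := (bool * lists T)%type (only parsing).

Lemma round_spec k s L : k < 7 -> layout G s -> rep s k L ->
  rep (den (pround k) s) k (round G L).
Proof.
move=> k7 e r; suff [] : layout G (den (pround k) s) /\ rep (den (pround k) s) k (round G L) by [].
apply: (@for_sim _ _ (fun s L => layout G s /\ rep s k L)) => //; first exact: layout_n e.
- move=> {e r}s {}L u [e r].
  suff [] : [/\ layout G (den (CFor vW (premove k)) (set_reg s vU (idx u))),
     rep (den (CFor vW (premove k)) (set_reg s vU (idx u))) k (remove_row G L u) &
     reg (den (CFor vW (premove k)) (set_reg s vU (idx u))) vU = idx u] by [].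
  apply: (@for_sim _ _ (fun s L => [/\ layout G s, rep s k L & reg s vU = idx u])).
  + exact: layout_n e.
  + move=> {e r}s {}L v [e r su].
    have e' : layout G (set_reg s vW (idx v)) by apply: layout_set.
    split; [| exact: remove_spec | by rewrite den_reg].
    by apply: layout_den e'; rewrite /nice /= ?k7.
  + by move=> {e r}s {}L i [e r su]; split=> //; apply: layout_set.
  by split=> //; apply: layout_set.
by move=> {e r}s {}L i [e r]; split=> //; apply: layout_set.
Qed.

Lemma foldl_iter3 (X Y : Type) (f : X -> X) (y : X) (r : seq Y) :
  foldl (fun y _ => f (f (f y))) y r = iter (3 * size r) f y.
Proof.
elim: r y => // a r IH y; rewrite [LHS]/= [size _]/=.
by rewrite IH -[f (f (f y))]/(iter 3 f y) -iterD mulnS addnC.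
Qed.

Lemma nice_round k : k < 7 -> nice (pround k).
Proof. by move=> k7; rewrite /nice /= ?k7. Qed.

Lemma prop_spec k s L : k < 7 -> layout G s -> rep s k L ->
  rep (den (pprop k) s) k (propagate G L).
Proof.
move=> k7 e r; have nr := nice_round k7.
have step t P : layout G t -> rep t k P ->
    layout G (den (pround k) t) /\ rep (den (pround k) t) k (round G P).
  by move=> et rt; split; [apply: layout_den | apply: round_spec].
rewrite /propagate cardT -foldl_iter3.
suff [] : layout G (den (pprop k) s) /\
  rep (den (pprop k) s) k (foldl (fun P (_ : T) => round G (round G (round G P))) L (enum T)) by [].
apply: (@for_sim _ _ (fun s L => layout G s /\ rep s k L)) => //; first exact: layout_n e.
  move=> t P v [et rt]; rewrite !den_seq.
  have e1 : layout G (set_reg t vR (idx v)) by apply: layout_set.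
  have [e2 r2] := step _ _ e1 rt; have [e3 r3] := step _ _ e2 r2.
  exact: step.
by move=> t P i [et rt]; split=> //; apply: layout_set.
Qed.

Lemma count_nlist L i : count (fun v => #|L v| == i) (enum T) = nlist L i.
Proof.
rewrite -sum1_count big_enum_cond /nlist -sum1_card /=.
by apply: eq_bigl => v; rewrite inE.
Qed.

Lemma count_rcons (A : Type) (p : pred A) r a : count p (rcons r a) = count p r + p a.
Proof. by rewrite -cats1 count_cat /= addn0. Qed.

Lemma count_spec k x s L : x \in [:: 14; 17; 20; 23] -> k < 7 -> layout G s -> rep s k L ->
  [/\ reg (den (pcount k x) s) x = nlist L 3, reg (den (pcount k x) s) x.+1 = nlist L 2
    & reg (den (pcount k x) s) x.+2 = nlist L 0].
Proof.
move=> xin k7 e r.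
pose R t ys := [/\ layout G t, rep t k L & [/\ reg t x = count (fun v => #|L v| == 3) ys,
  reg t x.+1 = count (fun v => #|L v| == 2) ys & reg t x.+2 = count (fun v => #|L v| == 0) ys]].
suff [_ _] : R (den (pcount k x) s) (enum T) by rewrite !count_nlist.
rewrite /pcount !den_seq.
apply: for_enum.
- by move: xin; rewrite !inE => /or4P[]/eqP->; exact: layout_n e.
- move=> t ys v [et rt [c3 c2 c0]].
  have et' : layout G (set_reg t vI (idx v)) by apply: layout_set.
  have sz := eval_size et' rt (erefl : reg (set_reg t vI (idx v)) vI = idx v).
  split.
  + apply: layout_den et'.
    by move: xin; rewrite !inE => /or4P[]/eqP->; rewrite /nice /= ?k7.
  + apply: (@rep_den _ G) => //; last by rewrite leqW.
    by move: xin; rewrite !inE => /or4P[]/eqP->; rewrite /nice /= ?k7.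
  rewrite !count_rcons !den_if !eval_sub sz.
  move: c3 c2 c0 (card_list L v); rewrite [eval _ (ECst 1)]/= [eval _ (ECst 2)]/=.
  move: xin; rewrite !inE => /or4P[]/eqP-> c3 c2 c0;
    by case: #|L v| => [|[|[|[|]]]] //= _; rewrite ?c3 ?c2 ?c0 !(addn0, addn1).
- move=> t ys i [et rt [c3 c2 c0]]; split=> //; first exact: layout_set.
  by move: xin c3 c2 c0; rewrite !inE => /or4P[]/eqP->.
rewrite /R; move: xin; rewrite !inE => /or4P[]/eqP->; (split;
  [apply: layout_set => //; apply: layout_set => //; exact: layout_set | exact: r | by []]).
Qed.

Lemma pclear_spec s k M x v (c : 'I_3) :
  k < 7 -> layout G s -> repf s k M -> reg s x = idx v ->
  repf (den (pclear k x c) s) k (fun u d => M u d && ~~ ((u == v) && (d == c))).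
Proof.
move=> k7 e r sx.
exact (@clear_spec T G s k M x v c true (ECst 1) k7 e r sx erefl).
Qed.

Definition branched s L v (c : 'I_3) :=
  let P := branch G L v c in
  [/\ rep s (aB c) P, reg s (vCntB c) = nlist P 3, reg s (vCntB c).+1 = nlist P 2
    & reg s (vCntB c).+2 = nlist P 0].

Lemma restrict_spec k s L v (c : 'I_3) : k < 7 -> layout G s -> rep s k L ->
  reg s vV = idx v -> rep (den (prestrict k c) s) k (restrict L v c).
Proof.
move=> k7 e r sv.
have step t M (d : 'I_3) : [/\ layout G t, repf t k M & reg t vV = idx v] ->
    [/\ layout G (den (pclear k vV d) t), repf (den (pclear k vV d) t) k
        (fun u b => M u b && ~~ ((u == v) && (b == d))) & reg (den (pclear k vV d) t) vV = idx v].
  move=> [et rt tv]; split; [| exact: pclear_spec | by rewrite den_reg].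
  by apply: layout_den; rewrite // /nice /= k7.
have h0 : [/\ layout G s, repf s k (fun v c => c \in L v) & reg s vV = idx v] by [].
have ext M t : repf t k M -> (forall u d, M u d = (d \in restrict L v c u)) ->
    rep t k (restrict L v c) by move=> rt eM; apply: repf_ext rt.
case: c ext => [[|[|[|//]]] i] ext.
- have [_ r2 _] := step _ _ (@Ordinal 3 2 isT) (step _ _ (@Ordinal 3 1 isT) h0).
  apply: ext r2 _ => u d; rewrite ffunE; case: (u == v); rewrite /= ?andbT // !inE -andbA; congr (_ && _).
  by have := mem_colours d; rewrite !inE => /or3P[]/eqP->.
- have [_ r2 _] := step _ _ (@Ordinal 3 2 isT) (step _ _ (@Ordinal 3 0 isT) h0).
  apply: ext r2 _ => u d; rewrite ffunE; case: (u == v); rewrite /= ?andbT // !inE -andbA; congr (_ && _).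
  by have := mem_colours d; rewrite !inE => /or3P[]/eqP->.
have [_ r2 _] := step _ _ (@Ordinal 3 1 isT) (step _ _ (@Ordinal 3 0 isT) h0).
apply: ext r2 _ => u d; rewrite ffunE; case: (u == v); rewrite /= ?andbT // !inE -andbA; congr (_ && _).
by have := mem_colours d; rewrite !inE => /or3P[]/eqP->.
Qed.

Lemma branch_spec s L v (c : 'I_3) : layout G s -> rep s aL L -> reg s vV = idx v ->
  branched (den (pbranch c) s) L v c.
Proof.
move=> e r sv; rewrite /pbranch 3!den_seq.
have c7 : aB c < 7 by have := ltn_ord c; lia.
have c8 : aB c < 8 by rewrite leqW.
set s1 := den (pcopy _ _) s.
have e1 : layout G s1 by apply: layout_den; rewrite // /nice /= !c7.
have r1 : rep s1 (aB c) L by apply: (@copy_spec _ G _ aL).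
have v1 : reg s1 vV = idx v by rewrite den_reg.
set s2 := den (prestrict _ _) s1.
have r2 : rep s2 (aB c) (restrict L v c) by apply: restrict_spec.
have e2 : layout G s2.
  apply: layout_den e1; rewrite /nice /=.
  by case: c c7 {c8 s1 r1 v1 s2 r2} => [[|[|[|]]] ?] /=.
set s3 := den (pprop _) s2.
have r3 : rep s3 (aB c) (branch G L v c) by apply: prop_spec.
have e3 : layout G s3 by apply: layout_den e2; rewrite /nice /= !c7.
have xin : vCntB c \in [:: 14; 17; 20; 23] by case: (c) => [[|[|[|]]] ?].
have [h3 h2 h0] := count_spec xin c7 e3 r3.
split=> //; apply: (@rep_den _ G) r3 => //.
Qed.

(** * Pushing frames *)

Lemma push_spec s k L m stk : k < 7 -> k != aS -> layout G s -> rep s k L ->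
  stack_ok s stk -> stack_ok (den (ppush k m) s) ((m, L) :: stk).
Proof.
move=> k7 k4 e r [sp st]; set o := size stk * (3 * n + 1) in sp *.
rewrite /ppush !den_seq; set s1 := den (pfill _ _ _) s.
have e1 : layout G s1 by apply: layout_den.
have [||h1 h2] := @fill_spec _ G aS (EVar vSp) (fun c => EArr k (epos vI c)) s o
  (fun v c => c \in L v) isT e.
- by move=> s' [a _]; rewrite /= a.
- move=> s' v c ag sI; rewrite /= (proj1 ag) // (layout_base e) sI -/(pos v c).
  by rewrite (agree_array _ ag) ?r // leqW.
have sp1 : reg s1 vSp = o by rewrite den_reg.
rewrite -/s1 in h1 h2; clearbody s1.
set s2 := den (CStore _ _ _) s1.
have m2 j : ram s2 (cell base aS j) = if j == o + 3 * n then nat_of_bool m else ram s1 (cell base aS j).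
  rewrite /s2 /= sp1 (layout_base e1) (layout_n e1) cell_eq //=.
  by rewrite (_ : n + (n + n) = 3 * n) //; lia.
have sp2 : reg s2 vSp = o by [].
have fr2 : reg s2 vFrame = 3 * n + 1 by rewrite -(layout_frame e1).
clearbody s2; split; first by rewrite /= sp2 fr2 mulSn addnC.
split=> [v c||] /=.
- by rewrite m2 -/o h1 eqn_add2l ifN // neq_ltn pos_lt.
- by rewrite m2 eqxx.
apply: stack_rep_ext st => j lt.
by rewrite m2 h2 // ifN // neq_ltn (leq_trans lt) // leq_addr.
Qed.

Definition all_branched s L v := forall c, branched s L v c.

Lemma branched_den p s L v : nice p -> layout G s ->
  all (fun k => (k != 1) && (k != 2) && (k != 3)) (array_writes p) ->
  all (fun x => (x < 17) || (25 < x)) (var_writes p) ->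
  all_branched s L v -> all_branched (den p s) L v.
Proof.
move=> np e /allP ap /allP xp br c; have [r h3 h2 h0] := br c.
have cc := ltn_ord c.
have out x : 17 <= x <= 25 -> x \notin var_writes p.
  by move=> lx; apply/negP=> /xp; lia.
split; rewrite ?den_reg //; try by apply: out; lia.
apply: (@rep_den _ G) r => //; first by lia.
apply/negP=> /ap; have : c \in colours by apply: mem_colours.
by rewrite !inE => /or3P[]/eqP->.
Qed.

Definition pushed m P stk : seq frame := if dead P then stk else (m, P) :: stk.

Lemma push_alive_spec s m L v (c : 'I_3) stk :
  layout G s -> all_branched s L v -> stack_ok s stk ->
  stack_ok (den (ppush_alive m c) s) (pushed m (branch G L v c) stk).
Proof.
move=> e br st; have [r _ _ h0] := br c.
rewrite /ppush_alive den_if [eval _ _]/= h0 /pushed /dead.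
case: eqP => // _; apply: push_spec => //; have := ltn_ord c; first by lia.
by case: (c) => [[|[|[|]]] ?].
Qed.

Lemma push_all_spec s m L v stk :
  layout G s -> all_branched s L v -> stack_ok s stk ->
  stack_ok (den (ppush_all m) s) (kids G m L v ++ stk).
Proof.
move=> e br st.
have step t q (c : 'I_3) : [/\ layout G t, all_branched t L v & stack_ok t q] ->
    [/\ layout G (den (ppush_alive m c) t), all_branched (den (ppush_alive m c) t) L v &
      stack_ok (den (ppush_alive m c) t) (pushed m (branch G L v c) q)].
  move=> [et bt qt]; split; last exact: push_alive_spec.
    exact: layout_den.
  exact: branched_den.
have h := step _ _ (@Ordinal 3 2 isT) (step _ _ (@Ordinal 3 1 isT)
  (step _ _ (@Ordinal 3 0 isT) (And3 e br st))).
rewrite (_ : kids G m L v ++ stk = foldl (fun q c => pushed m (branch G L v c) q) stk colours).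
  by case: h.
rewrite /kids; set B := branch G L v; rewrite /pushed /=.
by do 3![case: (dead _) => /=].
Qed.

(** * The two kinds of branching *)

Definition counted s L := reg s vCnt = nlist L 3 /\ reg s vCnt.+1 = nlist L 2.

Lemma weight_spec s L v (c : 'I_3) : counted s L -> branched s L v c ->
  reg (den (pweight c) s) vSum = reg s vSum + weight G L v c.
Proof.
move=> [l3 l2] [_ h3 h2 h0]; rewrite /pweight den_if [eval _ _]/= h0 /weight /dead.
case: eqP => [_|_]; last by rewrite addn0.
rewrite den_seq; set t := den (CSet vD _) s.
have tD : reg t vD = mass L - mass (branch G L v c).
  by rewrite /t /= l3 l2 h3 h2 /mass !mul2n !addnn.
have tS : reg t vSum = reg s vSum by [].
clearbody t.
rewrite !den_if !eval_sub ![eval t _]/= tD !subn_eq0 /score; move: (mass L - _) => D.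
by rewrite -tS; do 9![case: D => [|D] //].
Qed.

Lemma cheap_spec s L v stk :
  layout G s -> counted s L -> all_branched s L v -> stack_ok s stk -> reg s vDone = 0 ->
  reg (den pcheap s) vDone = cheap G L v /\
  stack_ok (den pcheap s) ((if cheap G L v then kids G false L v else [::]) ++ stk).
Proof.
move=> e cnt br st done.
have e1 : layout G (den (CSet vSum (ECst 0)) s) by apply: layout_den.
rewrite /pcheap 2!den_seq; set t0 := den (CSet _ _) s; set t := den (thrice pweight) t0.
have step q (c : 'I_3) : [/\ layout G q, counted q L & all_branched q L v] ->
    [/\ layout G (den (pweight c) q), counted (den (pweight c) q) L & all_branched (den (pweight c) q) L v].
  move=> [eq [l3 l2] bq]; split; first exact: layout_den.
    by split; rewrite den_reg.
  exact: branched_den.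
have h0 : [/\ layout G t0, counted t0 L & all_branched t0 L v].
  by split=> //; exact: branched_den.
have h1 := step _ (@Ordinal 3 0 isT) h0; have h2 := step _ (@Ordinal 3 1 isT) h1.
have [et ct bt] := step _ (@Ordinal 3 2 isT) h2.
have sum : reg t vSum = \sum_(c < 3) weight G L v c.
  rewrite sum_colours; case: h0 h1 h2 => _ c0 b0 [_ c1 b1] [_ c2 b2].
  rewrite [t]/(den (pweight 2) (den (pweight 1) (den (pweight 0) t0))).
  rewrite (weight_spec c2 (b2 (@Ordinal 3 2 isT))) (weight_spec c1 (b1 (@Ordinal 3 1 isT))).
  by rewrite (weight_spec c0 (b0 (@Ordinal 3 0 isT))).
have stt : stack_ok t stk by apply: (@stack_den _ G) => //; apply: (@stack_den _ G).
rewrite den_if eval_sub [eval t (EVar _)]/= sum [eval _ _]/= subn_eq0 -/(cheap G L v).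
case: (cheap G L v); last by rewrite !den_reg.
rewrite den_seq; split=> //; apply: (@stack_den _ G) => //; first exact: layout_den.
exact (push_all_spec false et bt stt).
Qed.

Lemma oppose_spec s L v (c : 'I_3) : layout G s -> rep s aL L -> all_branched s L v ->
  rep (den (poppose c) s) aO (oppose L (branch G L v c)).
Proof.
move=> e r br; have [rP _ _ _] := br c; set P := branch G L v c in rP *.
have c7 : aB c < 7 by have := ltn_ord c; lia.
have cO : aB c != aO by case: (c) => [[|[|[|]]] ?].
pose M (ys : seq T) u (d : 'I_3) := if u \in ys then d \in oppose L P u else d \in L u.
pose R t ys := [/\ layout G t, rep t aL L, rep t (aB c) P & repf t aO (M ys)].
suff [_ _ _] : R (den (poppose c) s) (enum T).
  by apply: repf_ext => u d; rewrite /M mem_enum.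
rewrite /poppose den_seq; apply: for_enum.
- by apply: layout_n (_ : layout G _); apply: layout_den.
- move=> t ys u [et rt rtP rM]; set t1 := set_reg t vI (idx u).
  have e1 : layout G t1 by apply: layout_set.
  have i1 : reg t1 vI = idx u by [].
  have fr q : nice q -> aL \notin array_writes q -> aB c \notin array_writes q ->
      repf (den q t1) aO (M (rcons ys u)) ->
      R (den q t1) (rcons ys u).
    move=> nq q0 qc rq; split=> //; first exact: layout_den.
      exact: (@rep_den _ G).
    by apply: (@rep_den _ G) => //; apply: leqW.
  apply: fr => //; first by rewrite /= !inE !negb_or !cO.
  have skip : (#|L u| == 3) && (#|P u| < 3) = false -> repf t1 aO (M (rcons ys u)).
    move=> no; apply: repf_ext rM => x d; rewrite /M mem_rcons inE.
    by case: eqP => //= ->; rewrite ffunE no; case: ifP.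
  rewrite den_if eval_sub (eval_size e1 rt i1) [eval _ _]/= subn_eq0.
  case: leqP => [l2|l3]; first by apply: skip; rewrite ltn_eqF.
  rewrite den_if eval_sub (eval_size e1 rtP i1) [eval _ _]/= subn_eq0.
  have u3 : #|L u| = 3 by apply/eqP; rewrite eqn_leq card_list.
  case: (ltnP #|P u| 3) => [l4|l4]; last by apply: skip; rewrite ltnNge l4 andbF.
  have step t2 M' (d : 'I_3) : [/\ layout G t2, rep t2 (aB c) P, repf t2 aO M' & reg t2 vI = idx u] ->
      let t3 := den (CIf (EArr (aB c) (epos vI d)) (pclear aO vI d) CSkip) t2 in
      [/\ layout G t3, rep t3 (aB c) P,
        repf t3 aO (fun x b => M' x b && ~~ [&& d \in P u, x == u & b == d]) & reg t3 vI = idx u].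
    move=> [e2 r2 m2 i2]; split; [exact: layout_den | | | by rewrite den_reg].
      by apply: (@rep_den _ G) => //; [exact: leqW | rewrite /= inE].
    apply: (@clear_spec _ G) => //.
    by rewrite [LHS]/= i2 (layout_base e2) -/(pos u d) r2.
  have h0 : [/\ layout G t1, rep t1 (aB c) P, repf t1 aO (M ys) & reg t1 vI = idx u] by [].
  have [_ _ + _] := step _ _ (@Ordinal 3 2 isT) (step _ _ (@Ordinal 3 1 isT)
    (step _ _ (@Ordinal 3 0 isT) h0)).
  apply: repf_ext => x d; rewrite /M mem_rcons inE.
  have [->|_] /= := eqVneq x u; last by rewrite !andbF !andbT.
  rewrite ffunE u3 l4 /= inE.
  have := mem_colours d; rewrite !inE => /or3P[]/eqP->;
    by rewrite !eqxx /= ?andbF ?andbT /= ?andbT; case: ifP; rewrite /= ?andbT // andbC;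
      case: (_ \in P u).
- move=> t ys i [et rt rtP rM]; split=> //; exact: layout_set.
split; first exact: layout_den.
- exact: (@rep_den _ G).
- by apply: (@rep_den _ G) => //; [exact: leqW | rewrite /= !inE !negb_or !cO].
exact: (@copy_spec _ G _ aL).
Qed.

End Commands.

(** * One step of the traversal *)

Section Step.
Variables (T : finType) (G : sgraph T).
Implicit Types (L P : lists T) (u v w : T) (s : state) (m : bool).

Local Notation n := #|T| (only parsing).
Local Notation base := (input_size T) (only parsing).
Local Notation frame := (bool * lists T)%type (only parsing).

Lemma eval_var s x : eval s (EVar x) = reg s x. Proof. by []. Qed.

Lemma eval_cst s c : eval s (ECst c) = c. Proof. by []. Qed.

Lemma mild_spec s L v (c : 'I_3) rest (X : seq frame) stk :
  layout G s -> counted s L -> rep s aL L -> all_branched G s L v -> stack_ok s stk ->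
  stack_ok (den rest s) (X ++ stk) ->
  stack_ok (den (pmild c rest) s)
    ((if mild G L v c then mild_kids G L v c else X) ++ stk).
Proof.
move=> e [l3 l2] r br st strest; have [rP h3 h2 h0] := br c.
have lc := ltn_ord c; set P := branch G L v c in rP h3 h2 h0.
rewrite /pmild den_if [eval _ _]/= h0 l3 h3 addn_eq0 subn_eq0 /mild -/P negbK.
case: ifP => // /andP[_ d2]; rewrite den_seq; set s1 := den (ppush _ _) s.
have c4 : aB c != aS by case: (c) => [[|[|[|]]] ?].
have c7 : aB c < 7 by lia.
have st1 : stack_ok s1 ((true, P) :: stk) by apply: (@push_spec _ G _ _ P true).
have e1 : layout G s1 by apply: layout_den.
rewrite den_if !eval_sub !eval_var eval_cst !den_reg // l3 h3 subn_eq0 /mild_kids -/P.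
have -> : (nlist L 3 - nlist P 3 == 2) = ~~ (nlist L 3 - nlist P 3 <= 1).
  by move: d2; case: (_ - _) => [|[|[|]]].
case: (_ <= 1) => //; rewrite den_seq.
have r1 : rep s1 aL L by apply: (@rep_den _ G).
have br1 : all_branched G s1 L v by apply: branched_den.
have r2 := oppose_spec c e1 r1 br1.
apply: (@push_spec _ G _ _ (oppose L P) true) => //; first exact: layout_den.
exact: (@stack_den _ G).
Qed.

Lemma settleE L v : settle G L v =
  foldr (fun c X => if mild G L v c then mild_kids G L v c else X)
    (kids G true L v) colours.
Proof. by rewrite /settle /=; do 3![case: ifP => //= _]. Qed.

Lemma ready_spec s L v stk :
  layout G s -> counted s L -> rep s aL L -> all_branched G s L v -> stack_ok s stk ->
  reg s vV = idx v -> reg s vDone = 0 ->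
  reg (den pready s) vDone = ready L v /\
  stack_ok (den pready s) ((if ready L v then settle G L v else [::]) ++ stk).
Proof.
move=> e cnt r br st sv done.
have cond : (eval s (ESub (ESub (esize aL vV) (ECst 1))
    (ESub (ECst 1) (ESub (ECst 1) (EVar vCnt)))) == 0) = ~~ ready L v.
  rewrite !eval_sub (eval_size e r sv) [eval s (EVar _)]/= (proj1 cnt).
  rewrite /ready [eval _ _]/=; have := card_list L v.
  by case: #|L v| => [|[|[|[|]]]]; case: (nlist L 3) => [|k].
rewrite /pready den_if cond; case: (ready L v); last by [].
rewrite den_seq; set q := pmild _ _.
have st' : stack_ok (den q s) (settle G L v ++ stk).
  rewrite settleE; apply: (@mild_spec s L v (@Ordinal 3 0 isT)) => //.
  apply: (@mild_spec s L v (@Ordinal 3 1 isT)) => //.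
  apply: (@mild_spec s L v (@Ordinal 3 2 isT)) => //.
  exact (push_all_spec true e br st).
split=> //; apply: (@stack_den _ G) => //; apply: layout_den => //.
Qed.

Lemma try_branches s L v : layout G s -> rep s aL L -> reg s vV = idx v ->
  all_branched G (den (thrice pbranch) s) L v.
Proof.
move=> e r sv.
have step t (c : 'I_3) : [/\ layout G t, rep t aL L & reg t vV = idx v] ->
    [/\ layout G (den (pbranch c) t), rep (den (pbranch c) t) aL L & reg (den (pbranch c) t) vV = idx v].
  move=> [et rt tv]; have nb : nice (pbranch c) by case: (c) => [[|[|[|]]] ?].
  split; first exact: layout_den.
    by apply: (@rep_den _ G) => //; case: (c) => [[|[|[|]]] ?].
  by rewrite den_reg //; case: (c) => [[|[|[|]]] ?].
have keep t (c d : 'I_3) : c != d -> layout G t -> branched G t L v c ->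
    branched G (den (pbranch d) t) L v c.
  case: c d => [[|[|[|//]]] ic] [[|[|[|//]]] id] // ne et [rt h3 h2 h0];
    by split; [exact: (@rep_den _ G) | rewrite den_reg..].
pose c0 := @Ordinal 3 0 isT; pose c1 := @Ordinal 3 1 isT; pose c2 := @Ordinal 3 2 isT.
have h0 : [/\ layout G s, rep s aL L & reg s vV = idx v] by [].
have h1 := step _ c0 h0; have h2 := step _ c1 h1.
move=> c; have := mem_colours c; rewrite !inE => /or3P[]/eqP->.
- apply: (@keep _ c0 c2) => //; first by case: h2.
  apply: (@keep _ c0 c1) => //; first by case: h1.
  exact: (@branch_spec _ G s L v c0).
- apply: (@keep _ c1 c2) => //; first by case: h2.
  by case: h1 => *; apply: (@branch_spec _ G _ L v c1).
by case: h2 => *; apply: (@branch_spec _ G _ L v c2).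
Qed.

Definition ctx m s L := [/\ layout G s, rep s aL L, counted s L & reg s vMode = m].

Lemma ctx_den m p s L : nice p -> aL \notin array_writes p -> vCnt \notin var_writes p ->
  vCnt.+1 \notin var_writes p -> vMode \notin var_writes p -> ctx m s L -> ctx m (den p s) L.
Proof.
move=> np p0 p1 p2 p3 [e r [l3 l2] sm]; split; last by rewrite den_reg.
- exact: layout_den.
- exact: (@rep_den _ G).
by split; rewrite den_reg.
Qed.

(** The first suitable vertex in the order of enumeration, by a fold. *)
Definition found m L (y : option (seq frame)) v :=
  if y is Some _ then y
  else if suits G m L v then Some (if m then settle G L v else kids G m L v)
  else None.

(** The invariant of the loop over the vertices: the children of the first
    suitable vertex, once it is found, have been pushed on the stack [stk]. *)
Definition search m L s (y : option (seq frame)) stk :=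
  [/\ ctx m s L, reg s vDone = isSome y & stack_ok s (odflt [::] y ++ stk)].

Lemma try_spec m L s y v stk : search m L s y stk -> reg s vV = idx v ->
  search m L (den ptry s) (found m L y v) stk.
Proof.
move=> [cx done st] sv; have cx' : ctx m (den ptry s) L by apply: ctx_den cx; vm_compute.
suff [h1 h2] : reg (den ptry s) vDone = isSome (found m L y v) /\
  stack_ok (den ptry s) (odflt [::] (found m L y v) ++ stk) by [].
rewrite /ptry den_if eval_var done {cx'}.
case: y done st => [k|] done st //.
rewrite [_ == 0](_ : _ = true) // den_seq; have [e r cnt sm] := cx.
have br := try_branches e r sv.
set t := den (thrice pbranch) s in br *.
have [e' r' cnt' sm'] : ctx m t L by apply: ctx_den cx; vm_compute.
have tv : reg t vV = idx v by rewrite den_reg //; vm_compute.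
have td : reg t vDone = 0 by rewrite den_reg //; vm_compute.
have stt : stack_ok t stk by apply: (@stack_den _ G) st; vm_compute.
clearbody t; rewrite den_if eval_var sm' /found /suits; case: (m).
  have [] := ready_spec e' cnt' r' br stt tv td.
  rewrite [_ == 0](_ : _ = false) //; move: (den pready t) => t' -> h.
  by case: (ready L v) h.
have [] := cheap_spec e' cnt' br stt td.
rewrite [_ == 0](_ : _ = true) //; move: (den pcheap t) => t' -> h.
by case: (cheap G L v) h.
Qed.

Lemma foldl_found m L (r : seq T) :
  foldl (found m L) None r =
  if [seq v <- r | suits G m L v] is v :: _
  then Some (if m then settle G L v else kids G m L v) else None.
Proof.
elim: r => //= v r IH; case: (suits G m L v) => //=.
by elim: r {IH}.
Qed.

Lemma expand_spec m L s stk : ctx m s L -> stack_ok s stk ->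
  stack_ok (den pexpand s) (expand G m L ++ stk).
Proof.
move=> cx st; rewrite /pexpand 2!den_seq.
set s1 := den (CSet vDone _) s.
have h1 : search m L s1 None stk.
  split; [by apply: ctx_den cx | by [] | ].
  by case: cx => e *; apply: (@stack_den _ G).
have en : reg s1 vN = n by case: h1 => [[e _ _ _] _ _]; apply: layout_n e.
have : search m L (den (CFor vV ptry) s1) (foldl (found m L) None (enum T)) stk.
  apply: (for_sim (R := fun s y => search m L s y stk)) => //.
    move=> t y v h; apply: try_spec => //; case: h => [[e r c sm] d st'].
    split=> //; first by split=> //; apply: layout_set.
    by case: st' => a b; split=> //; apply: stack_rep_ext b.
  move=> t y i [[e r c sm] d [a b]]; split=> //; first by split=> //; apply: layout_set.
  by split=> //; apply: stack_rep_ext b.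
move: (den (CFor vV ptry) s1) => t; rewrite foldl_found /expand => {h1 en s1}.
case: [seq v <- enum T | suits G m L v] => [|v q] [[e r c sm] d st'];
  rewrite den_if eval_var d //.
by apply: (@push_spec _ G _ _ L true).
Qed.

Lemma pop_spec s m L stk : layout G s -> stack_ok s ((m, L) :: stk) ->
  [/\ layout G (den ppop s), rep (den ppop s) aL L, reg (den ppop s) vMode = m &
    stack_ok (den ppop s) stk].
Proof.
move=> e [sp [rL rm st]]; set o := size stk * (3 * n + 1) in rL rm.
rewrite /ppop 2!den_seq; set s1 := den (CSet _ _) s.
have e1 : layout G s1 by apply: layout_den.
have sp1 : reg s1 vSp = o.
  by rewrite /s1 /= sp (layout_frame e) /= mulSn addKn.
have ram1 : ram s1 = ram s by [].
clearbody s1; set s2 := den (pfill _ _ _) s1.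
have e2 : layout G s2 by apply: layout_den.
have [||h1 _] := @fill_spec _ G aL (ECst 0)
  (fun c => EArr aS (EAdd (EVar vSp) (epos vI c))) s1 0 (fun v c => c \in L v) isT e1.
- by [].
- move=> s' v c ag sI; rewrite /= sI !(proj1 ag) // (layout_base e1) sp1 -/(pos v c).
  by rewrite (agree_array _ ag) // ram1 rL.
have sp2 : reg s2 vSp = o by rewrite den_reg.
have st2 : stack_rep s2 stk.
  by apply: stack_rep_ext st => j _; rewrite (@den_array _ G) // ram1.
have m2 : ram s2 (cell base aS (o + 3 * n)) = m by rewrite (@den_array _ G) // ram1.
rewrite -/s2 in h1; clearbody s2; split.
- exact: layout_den.
- exact: h1.
- by rewrite /= sp2 (layout_base e2) (layout_n e2) (_ : n + (n + n) = 3 * n) //; lia.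
by split=> //; apply: stack_rep_ext st2.
Qed.

Definition loop_inv s (stk : seq frame) :=
  [/\ layout G s, stack_ok s stk, reg s vRun = 1 & reg s vAns = 0].

Lemma step_spec s stk : loop_inv s stk ->
  match stack_step G stk with
  | inl stk' => loop_inv (den pstep s) stk'
  | inr b => reg (den pstep s) vRun = 0 /\ reg (den pstep s) vAns = b
  end.
Proof.
move=> [e st run ans]; rewrite /pstep den_if eval_var (proj1 st).
case: stk st => [|[m L0] r] st; first by [].
rewrite [_ == 0](_ : _ = false); last by apply/eqP => /=; lia.
rewrite 3!den_seq; have [e1 r1 m1 st1] := pop_spec e st.
have run1 : reg (den ppop s) vRun = 1 by rewrite den_reg.
have ans1 : reg (den ppop s) vAns = 0 by rewrite den_reg.
move: (den ppop s) e1 r1 m1 st1 run1 ans1 => s1 e1 r1 m1 st1 run1 ans1 {s e st run ans}.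
have r2 := prop_spec (isT : aL < 7) e1 r1.
set s2 := den (pprop aL) s1 in r2 *.
have e2 : layout G s2 by apply: layout_den.
have m2 : reg s2 vMode = m by rewrite den_reg.
have run2 : reg s2 vRun = 1 by rewrite den_reg.
have ans2 : reg s2 vAns = 0 by rewrite den_reg.
have st2 : stack_ok s2 r by apply: (@stack_den _ G) st1.
clearbody s2; rewrite /stack_step; set L := propagate G L0 in r2 *.
have [n3 n2 n0] := count_spec (isT : vCnt \in [:: 14; 17; 20; 23]) (isT : aL < 7) e2 r2.
set s3 := den (pcount aL vCnt) s2 in n3 n2 n0 *.
have e3 : layout G s3 by apply: layout_den.
have r3 : rep s3 aL L by apply: (@rep_den _ G).
have m3 : reg s3 vMode = m by rewrite den_reg.
have run3 : reg s3 vRun = 1 by rewrite den_reg.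
have ans3 : reg s3 vAns = 0 by rewrite den_reg.
have st3 : stack_ok s3 r by apply: (@stack_den _ G) st2.
clearbody s3; rewrite den_if eval_var n0 /dead.
case: (nlist L 0 == 0); last by split.
rewrite den_if [eval _ _](_ : _ = nlist L 3 + nlist L 2); last by rewrite -n3 -n2.
case: (_ == 0); first by split.
have cx : ctx m s3 L by split.
split; [exact: layout_den | exact: expand_spec | |]; by rewrite den_reg //; vm_compute.
Qed.

End Step.

(** * The main program *)

Definition pzero (xs : seq nat) := foldr (fun x q => CSet x (ECst 0) ;; q) CSkip xs.

(** Clearing the scratch variables keeps all registers short from one round of
    the main loop to the next. *)
Definition pbody := pstep ;; pzero (iota 6 21).

Definition pinit :=
  CSet vBase (ECst 1) ;;
  CFor vI (CSet vBase (EAdd (EVar vBase) (EVar vN))) ;;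
  CSet vBase (EAdd (EVar vBase) (triple (EVar vN))) ;;
  CSet vFrame (EAdd (triple (EVar vN)) (ECst 1)) ;;
  CSet vD (ECst 0) ;;
  CFor vI (CStore aRow (EVar vI) (EVar vD) ;;
           CSet vD (EAdd (EVar vD) (EVar vN))) ;;
  pfill aS (ECst 0)
    (fun c => EMem (EAdd (ESub (EVar vBase) (triple (EVar vN))) (epos vI c))) ;;
  CStore aS (triple (EVar vN)) (ECst 0) ;;
  CSet vSp (EVar vFrame) ;;
  CSet vRun (ECst 1) ;;
  pzero (iota 6 21).

(** Ten temporaries suffice for all expressions of the program. *)
Definition wipe := seqs [seq Const (tmp d) 0 | d <- iota 0 10].

Definition with_wipe p := Seq (compile p) wipe.

Definition body := with_wipe pbody.

Definition main :=
  Seq (Get vN.*2 0) (Seq (with_wipe pinit) (While vRun.*2 body)).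

Lemma zero_reg xs s x :
  reg (den (pzero xs) s) x = if x \in xs then 0 else reg s x.
Proof.
elim: xs s => // y xs IH s; rewrite [pzero _]/= den_seq IH inE /=.
by case: (x \in xs); rewrite ?orbT ?orbF //; case: eqP.
Qed.

Lemma zero_ram xs s : ram (den (pzero xs) s) = ram s.
Proof. by elim: xs s => // y xs IH s; rewrite [pzero _]/= den_seq IH. Qed.

Lemma for_nat (I : nat -> state -> Prop) x p s n :
  reg s vN = n ->
  (forall k t, k < n -> I k t -> I k.+1 (den p (set_reg t x k))) ->
  (forall k t i, I k t -> I k (set_reg t x i)) ->
  I 0 s -> I n (den (CFor x p) s).
Proof.
move=> sn step out i0; rewrite /= sn; apply: out.
suff : forall k r t, k + r = n -> I k t ->
    I n (foldl (fun s k => den p (set_reg s x k)) t (iota k r)) by apply.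
move=> k r; elim: r k => [|r IH] k t /= kr Ik; first by rewrite -kr addn0.
by apply: IH; [rewrite addSnnS | apply: step => //; lia].
Qed.

Lemma nth_allpairs (A B : Type) (f : A -> B -> nat) (xs : seq A) (ys : seq B) x0 y0 i j r :
  i < size xs -> j < size ys ->
  nth 0 ([seq f x y | x <- xs, y <- ys] ++ r) (i * size ys + j) = f (nth x0 xs i) (nth y0 ys j).
Proof.
elim: xs i => //= x xs IH [|i] lt ltj; rewrite -catA nth_cat size_map.
  by rewrite ltj (nth_map y0).
by rewrite mulSn -addnA ltnNge leq_addr /= addKn IH.
Qed.

Section Run.
Variables (T : finType) (G : sgraph T).
Implicit Types (L : lists T) (s a : state).

Local Notation n := #|T| (only parsing).
Local Notation base := (input_size T) (only parsing).

(** * Reading the input *)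

Section Encoding.
Variable L : lists T.
Local Notation w := (encode G L) (only parsing).

Lemma nth_idx u v : nth v (enum T) (idx u) = u.
Proof. by rewrite nth_index // mem_enum. Qed.

Lemma size_enumT : size (enum T) = n.
Proof. by rewrite -cardT. Qed.

Lemma input_adj u v : nth 0 w (1 + idx u * n + idx v) = G u v.
Proof.
rewrite /encode -addnA [nth _ _ _]/= -{1}size_enumT.
by rewrite (nth_allpairs _ u u) ?size_enumT ?idx_lt // !nth_idx.
Qed.

Lemma size_adj : size [seq nat_of_bool (G u v) | u <- enum T, v <- enum T] = n * n.
Proof. by rewrite size_allpairs size_enumT. Qed.

Lemma input_list v (c : 'I_3) : nth 0 w (1 + n * n + pos v c) = (c \in L v).
Proof.
rewrite /encode -addnA [nth _ _ _]/= nth_cat size_adj add0n ltnNge leq_addr /= addKn.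
rewrite -[X in nth 0 X _]cats0 (_ : pos v c = idx v * size (enum 'I_3) + c).
  by rewrite (nth_allpairs _ v c) ?size_enumT ?idx_lt ?size_enum_ord // nth_idx nth_ord_enum.
by rewrite size_enum_ord /pos; lia.
Qed.

Lemma input_le i : nth 0 w i <= n * n + 1.
Proof.
have n2 : n <= n * n by case: (n) => // k; rewrite leq_pmulr.
have [lt|ge] := ltnP i (size w); last by rewrite nth_default.
have := mem_nth 0 lt; rewrite {2}/encode inE mem_cat => /or3P[/eqP->|/allpairsP|/allpairsP].
- by rewrite (leq_trans n2) ?leq_addr.
- by move=> [p [_ _ ->]]; rewrite (leq_trans (leq_b1 _)) ?leq_addl.
by move=> [p [_ _ ->]]; rewrite (leq_trans (leq_b1 _)) ?leq_addl.
Qed.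

Definition start := set_reg (init_state w) vN n.

Lemma init_ok :
  loop_inv G (den pinit start) [:: (false, L)] /\
  (forall i, ram (den pinit start) i <= n * n + 1).
Proof.
have ans : reg (den pinit start) vAns = 0 by rewrite den_reg.
suff [h1 h2 h3 h4] : [/\ layout G (den pinit start),
    stack_ok (den pinit start) [:: (false, L)], reg (den pinit start) vRun = 1
    & forall i, ram (den pinit start) i <= n * n + 1] by [].
rewrite {ans}/pinit 3!den_seq; set s1 := den (CFor _ _) _.
have [b1 [n1 m1]] : reg s1 vBase = 1 + n * n /\ reg s1 vN = n /\ ram s1 = ram start.
  apply: (@for_nat (fun k t => reg t vBase = 1 + k * n /\ reg t vN = n /\ ram t = ram start)) => //.
  move=> k t _ [tb [tn tm]]; split; last by [].
  by rewrite /= tb tn mulSn -addnA (addnC (k * n)).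
clearbody s1; rewrite 3!den_seq; set s2 := den (CSet vD _) _.
have [b2 n2 f2 d2 m2] : [/\ reg s2 vBase = base, reg s2 vN = n, reg s2 vFrame = 3 * n + 1,
    reg s2 vD = 0 & ram s2 = ram start].
  split=> //=; first by rewrite b1 n1 /input_size; lia.
  by rewrite n1 !mulSn mul0n addn0.
clearbody s2; rewrite den_seq; set s3 := den (CFor _ _) _.
pose I k t := [/\ [/\ reg t vBase = base, reg t vN = n, reg t vFrame = 3 * n + 1 & reg t vD = k * n],
  forall j, j < k -> ram t (cell base aRow j) = j * n,
  forall i, i < base -> ram t i = nth 0 w i & forall i, ram t i <= n * n + 1].
have [[b3 n3 f3 d3] row3 inp3 le3] : I n s3.
  apply: for_nat => //; last first.
    by split; rewrite ?m2 // => i; apply: input_le.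
  move=> k t lt [[tb tn tf td] row inp le].
  have kn : k * n <= n * n by rewrite leq_mul2r ltnW ?orbT.
  split; first by split; rewrite /= ?tb ?tn ?tf ?td // mulSn addnC.
  - move=> j; rewrite ltnS leq_eqVlt /= tb td cell_eq //= => /orP[/eqP->|jk].
      by rewrite eqxx.
    by rewrite ltn_eqF ?row.
  - by move=> i ib; rewrite /= tb ltn_eqF ?inp // (leq_trans ib) // /cell leq_addr.
  move=> i /=; rewrite td; case: ifP => _; last exact: le.
  exact: leq_trans kn (leq_addr _ _).
clearbody s3; have e3 : layout G s3.
  split=> // [u v|u]; first by rewrite inp3 ?adj_lt // input_adj.
  by rewrite row3 ?idx_lt.
rewrite 3!den_seq; set s4 := den (pfill _ _ _) _.
have [||h _] := @fill_spec _ G aS (ECst 0)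
  (fun c => EMem (EAdd (ESub (EVar vBase) (triple (EVar vN))) (epos vI c)))
  s3 0 (fun v c => c \in L v) isT e3.
- by [].
- move=> s' v c [a1 a2] sI; rewrite /= sI !a1 // b3 n3 -/(pos v c).
  rewrite (_ : base - (n + (n + n)) = 1 + n * n); last by rewrite /input_size; lia.
  have lt : 1 + n * n + pos v c < base by have := pos_lt v c; rewrite /input_size ltn_add2l.
  rewrite a2 ?inp3 ?input_list // => j.
  by rewrite ltn_eqF // (leq_trans lt) // /cell leq_addr.
have e4 : layout G s4 by apply: layout_den.
have le4 : forall i, ram s4 i <= n * n + 1 by apply: den_tame => //; rewrite addn1.
rewrite -/s4 in h; clearbody s4.
set s5 := den (CStore _ _ _) s4.
have e5 : layout G s5 by apply: layout_den.
have le5 : forall i, ram s5 i <= n * n + 1 by apply: den_tame => //; rewrite addn1.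
have [h5 o5] : (forall v (c : 'I_3), ram s5 (cell base aS (pos v c)) = (c \in L v)) /\
    ram s5 (cell base aS (3 * n)) = false.
  have n4 := layout_n e4; have b4 := layout_base e4.
  rewrite /s5 /= n4 b4 (_ : n + (n + n) = 3 * n); last by lia.
  split; last by rewrite eqxx.
  by move=> v c; rewrite cell_eq //= ltn_eqF ?pos_lt // -h.
clearbody s5; set s6 := den (pzero _) _.
have m6 : ram s6 = ram s5 by rewrite zero_ram.
split.
- by do 3![apply: layout_den => //].
- split; first by rewrite zero_reg /= (layout_frame e5) mul1n.
  by split=> // [v c|]; rewrite m6.
- by rewrite zero_reg.
by move=> i; rewrite m6.
Qed.

End Encoding.
End Run.

(** * Absorbing polynomial factors *)

Section Absorb.
Variable R : realType.
Local Open Scope ring_scope.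

(** Bernoulli's inequality. *)
Lemma expr_unbounded (r x : R) : 1 < r -> exists m, x <= r ^+ m.
Proof.
move=> r1; have bern m : 1 + m%:R * (r - 1) <= r ^+ m.
  elim: m => [|m IH]; first by rewrite mul0r addr0 expr0.
  rewrite exprS; apply: le_trans (ler_wpM2l (ltW (lt_trans ltr01 r1)) IH).
  rewrite -subr_ge0 (_ : _ - _ = m%:R * (r - 1) ^+ 2); first by rewrite mulr_ge0 ?sqr_ge0.
  by rewrite -[in LHS]natr1; ring.
have [m le] : exists m : nat, x <= m%:R * (r - 1).
  exists (Num.truncn (x / (r - 1))).+1.
  by rewrite -ler_pdivrMr ?subr_gt0 // ltW ?truncnS_gt.
by exists m; apply: le_trans le _; apply: le_trans (bern m); rewrite lerDr.
Qed.

Lemma beta_lt : beta R ^+ 2 < 13196 / 10000.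
Proof. by rewrite /beta; lra. Qed.

(** Let [r > 1] be the ratio of the square root of 1.3196 and [beta].  Either
    [N ^+ k <= r ^+ h], and [r ^+ h] is what the claimed base gains over [beta];
    or [r ^+ h < N ^+ k], and then [beta ^+ h] is itself bounded by a power of
    [N], because [beta] is at most a power of [r]. *)
Lemma absorb_poly (k : nat) : exists K : nat, forall (n h : nat),
  n.+1%:R ^+ k * beta R ^+ h <= n.+1%:R ^+ K + (13196 / 10000) `^ (2^-1 * h%:R).
Proof.
set B : R := 13196 / 10000; pose r := B `^ 2^-1 / beta R.
have b1 : 1 <= beta R := beta_ge1 R.
have b0 : 0 < beta R by apply: lt_le_trans b1.
have B0 : 0 <= B by rewrite /B; lra.
have s2 : (B `^ 2^-1) ^+ 2 = B.
  by rewrite -powR_mulrn ?powR_ge0 // -powRrM mulVf ?powRr1 // pnatr_eq0.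
have r1 : 1 < r.
  rewrite ltr_pdivlMr // mul1r -(ltr_pXn2r (_ : 0 < 2)%N) ?nnegrE ?powR_ge0 ?(ltW b0) //.
  by rewrite s2 beta_lt.
have [m le_m] := expr_unbounded (beta R) r1.
exists (k + k * m)%N => n h; set N : R := n.+1%:R.
have N0 : 0 <= N by [].
have -> : B `^ (2^-1 * h%:R) = r ^+ h * beta R ^+ h.
  rewrite powRrM powR_mulrn ?powR_ge0 // -exprMn /r mulfVK //; exact: lt0r_neq0.
have [le|lt] := leP (N ^+ k) (r ^+ h).
  rewrite -[X in X <= _]add0r; apply: lerD; first exact: exprn_ge0.
  by apply: ler_wpM2r => //; apply/exprn_ge0/ltW.
apply: (@le_trans _ _ (N ^+ (k + k * m))); last first.
  rewrite lerDl mulr_ge0 ?exprn_ge0 ?(ltW b0) //.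
  exact: ltW (lt_trans ltr01 r1).
rewrite exprD; apply: ler_wpM2l; first exact: exprn_ge0.
apply: (@le_trans _ _ ((r ^+ m) ^+ h)).
  by apply: lerXn2r => //; rewrite nnegrE ?(ltW b0) ?exprn_ge0 ?(ltW (lt_trans ltr01 r1)).
rewrite -exprM mulnC !exprM; apply: lerXn2r; rewrite ?nnegrE ?exprn_ge0 ?(ltW lt) //.
exact: ltW (lt_trans ltr01 r1).
Qed.

End Absorb.

(** * Running time *)

Lemma seqs_const_ok ds s b : 0 < b -> fits b s ->
  exists s', [/\ steps b (size ds + 1) (seqs [seq Const (tmp d) 0 | d <- ds]) s s',
    ram s' = ram s &
    forall i, reg s' i = if i \in [seq tmp d | d <- ds] then 0 else reg s i].
Proof.
elim: ds s b => [|d ds IH] s b b0 f; first by exists s; split=> //; apply: steps_Skip.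
have st := steps_Const f (tmp d) 0.
have b1 : 0 < b + 1 by lia.
have [s' [st' m' r']] := IH _ _ b1 (proj2 st).
exists s'; split=> //; first exact: steps_seq st _.
move=> i; rewrite r' inE regE.
by case: (i \in _); rewrite ?orbT ?orbF.
Qed.

Lemma steps_reg b m p s s' i : steps b m p s s' -> i \notin reg_writes p -> reg s' i = reg s i.
Proof. by move=> [[t ex _] _]; apply: exec_reg ex. Qed.

Lemma odd_tmp i : odd i -> i < 20 -> i \in [seq tmp d | d <- iota 0 10].
Proof.
move=> oi lt; apply/mapP; exists i./2; last by rewrite /tmp -[LHS]odd_double_half oi.
by rewrite mem_iota /= add0n; lia.
Qed.

Lemma with_wipe_ok p s a b n :
  0 < b -> wf p -> vN \notin var_writes p ->
  all (fun i => ~~ odd i || (i < 20)) (reg_writes (compile p)) ->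
  reg a vN = n -> fits b s -> sim s a -> (forall i, odd i -> reg s i = 0) ->
  exists s', [/\ steps b (ops n p + 11) (with_wipe p) s s', sim s' (den p a)
    & forall i, odd i -> reg s' i = 0].
Proof.
move=> b0 wp np /allP lt an f sm odds.
have [s1 [st1 sm1]] := compile_ok b0 wp np an f sm.
have b1 : 0 < b + ops n p by lia.
have [s2 [st2 m2 r2]] := seqs_const_ok (iota 0 10) b1 (proj2 st1).
exists s2; split; first exact: (steps_seq st1).
  split=> [x|x]; last by rewrite m2; case: sm1.
  rewrite r2 ifN ?(proj1 sm1) //; apply/mapP=> -[d _ e].
  by have := even_tmp d x; rewrite e eqxx.
move=> i oi; rewrite r2; case: ifPn => // ni; rewrite (steps_reg st1) ?odds //.
by apply: contra ni => /lt; rewrite oi => /odd_tmp; apply.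
Qed.

(** The rank of the root is at most [2 * n + 1], and [run_lists] asks for three
    times the rank, plus one. *)
Definition stack_limit n := 6 * n + 10.

(** A bound for every register and every memory cell at the start of a round. *)
Definition width n := 1 + n * n + 3 * n + (stack_limit n).+1 * (3 * n + 1) + 1.

Definition step_ops n := ops n pbody + 11.

Definition step_cost n := step_ops n * (2 * (width n + step_ops n)) + 2.

Definition init_ops n := ops n pinit + 11.

Definition init_cost n := width n + 1 + init_ops n * (2 * (width n + init_ops n)).

Section Run.
Variables (T : finType) (G : sgraph T).
Implicit Types (L : lists T) (s a : state).

Local Notation n := #|T| (only parsing).
Local Notation base := (input_size T) (only parsing).

(** What makes the words short: scratch variables and temporaries are zero and
    the memory is bounded. *)
Definition clean s a :=
  [/\ sim s a, forall x, 5 < x -> reg a x = 0, forall i, odd i -> reg s i = 0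
    & forall i, ram a i <= n * n + 1].

Lemma lt_width x : x <= width n -> x < 2 ^ width n.
Proof. by move=> le; apply: leq_ltn_trans le (ltn_expl _ _). Qed.

Lemma width_gt0 k : 0 < width k. Proof. by rewrite /width addn1. Qed.

Lemma clean_fits s a stk : clean s a -> loop_inv G a stk -> size stk <= stack_limit n ->
  fits (width n) s.
Proof.
move=> [[sr sm] z o le] [e [sp _] run ans] sz; split=> i; apply: lt_width; last first.
  by rewrite sm (leq_trans (le i)) // /width; lia.
have szF : size stk * (3 * n + 1) <= (stack_limit n).+1 * (3 * n + 1).
  by rewrite leq_mul2r (leqW sz) orbT.
case oi: (odd i); first by rewrite o.
rewrite -[i]odd_double_half oi add0n sr.
case: (leqP (i./2) 5) => [|/z->//].
case: (i./2) => [|[|[|[|[|[|k]]]]]] // _.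
- by rewrite ans.
- by rewrite (layout_base e) /width /input_size; lia.
- by rewrite (layout_n e) /width; lia.
- by rewrite sp /width; lia.
- by rewrite (layout_frame e) /width; lia.
by rewrite run /width; lia.
Qed.

(** The layout and the stack are preserved by [step_spec]; the bounds on the
    words are restored by the clearing at the end of the body. *)
Lemma body_ok s a stk :
  clean s a -> loop_inv G a stk -> size stk <= stack_limit n ->
  exists s', [/\ steps (width n) (step_ops n) body s s', clean s' (den pbody a) &
    match stack_step G stk with
    | inl stk' => loop_inv G (den pbody a) stk'
    | inr b => reg (den pbody a) vRun = 0 /\ reg (den pbody a) vAns = b
    end].
Proof.
move=> cl iv sz; have f := clean_fits cl iv sz; have [sm z o le] := cl.
have an : reg a vN = n by case: iv => e _ _ _; apply: layout_n e.
have w0 : wf pbody by vm_compute.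
have w1 : vN \notin var_writes pbody by vm_compute.
have w2 : all (fun i => ~~ odd i || (i < 20)) (reg_writes (compile pbody)) by vm_compute.
have [s' [st sm' o']] := with_wipe_ok (width_gt0 n) w0 w1 w2 an f sm o.
exists s'; split; first exact: st.
  split; [exact: sm' | | exact: o' |
    by apply: den_tame; [rewrite addn1 | vm_compute | ]].
  move=> x x5; rewrite /pbody den_seq zero_reg; case: ifPn => // nx.
  rewrite den_reg ?z //; apply: contra nx => xw.
  have /allP/(_ x xw) : all (fun x => x < 27) (var_writes pstep) by vm_compute.
  by rewrite mem_iota x5.
have := step_spec iv; rewrite /pbody den_seq; move: (den pstep a) => a1.
case: (stack_step G stk) => [stk'|b]; last by rewrite !zero_reg.
move=> [e1 st1 run1 ans1]; split; [| | by rewrite zero_reg | by rewrite zero_reg].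
  by apply: layout_den e1; vm_compute.
by apply: (@stack_den _ G) st1; vm_compute.
Qed.

Lemma loop_ok stk j b s a :
  stack_run G (stack_limit n) stk j b -> clean s a -> loop_inv G a stk ->
  exists t s', [/\ exec (While vRun.*2 body) s t s', reg s' 0 = b
    & t <= j * step_cost n].
Proof.
move=> run; elim: run s a => {stk j b} [stk b sz stp|stk stk' j b sz stp _ IH] s a cl iv;
  have [s1 [[[t1 ex1 le1] _] cl1]] := body_ok cl iv sz; rewrite stp;
  have run1 : reg s vRun.*2 = 1 by
    (have [[sr0 _] _ _ _] := cl; have [_ _ run1 _] := iv; rewrite sr0).
- move=> [r0 rb]; have [[sr _] _ _ _] := cl1.
  exists (bitlen (reg s vRun.*2) + t1 + bitlen (reg s1 vRun.*2)), s1; split.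
  + apply: exec_While_true ex1 _; first by rewrite run1.
    by apply: exec_While_false; rewrite sr.
  + by rewrite (sr 0).
  rewrite run1 (sr vRun) r0 mul1n /step_cost.
  by rewrite (_ : bitlen 1 = 1) // (_ : bitlen 0 = 1) //; lia.
move=> iv1; have [t2 [s2 [ex2 rb le2]]] := IH s1 _ cl1 iv1.
exists (bitlen (reg s vRun.*2) + t1 + t2), s2; split=> //.
  by apply: exec_While_true ex1 ex2; rewrite run1.
rewrite run1 mulSn; apply: leq_add le2; rewrite /step_cost (_ : bitlen 1 = 1) //; lia.
Qed.

Lemma main_ok L j b : stack_run G (stack_limit n) [:: (false, L)] j b ->
  exists t s', [/\ exec main (init_state (encode G L)) t s', reg s' 0 = b
    & t <= init_cost n + j * step_cost n].
Proof.
move=> run; set s0 := init_state _.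
pose s1 := set_reg s0 vN.*2 n.
have ex1 : exec (Get vN.*2 0) s0 (bitlen (reg s0 0) + bitlen (ram s0 (reg s0 0))) s1.
  exact: exec_Get.
have sm1 : sim s1 (start G L).
  by split=> // x; rewrite /s1 /start !regE -!muln2 eqn_mul2r.
have le1 i : ram s1 i <= n * n + 1 := input_le G L i.
have leW : n * n + 1 <= width n by rewrite /width; lia.
have nW : n <= width n by rewrite /width; lia.
have f1 : fits (width n) s1.
  split=> i; apply: lt_width; last exact: leq_trans (le1 i) leW.
  by rewrite regE; case: ifP.
have o1 i : odd i -> reg s1 i = 0 by rewrite regE; case: eqP => // ->.
have w0 : wf pinit by vm_compute.
have w1 : vN \notin var_writes pinit by vm_compute.
have w2 : all (fun i => ~~ odd i || (i < 20)) (reg_writes (compile pinit)) by vm_compute.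
have [|s2 [[[t2 ex2 le2] _] sm2 o2]] :=
  with_wipe_ok (a := start G L) (n := n) (width_gt0 n) w0 w1 w2 _ f1 sm1 o1.
  by rewrite /start regE.
have [iv2 m2] := init_ok G L.
have cl2 : clean s2 (den pinit (start G L)).
  split=> // x x5.
  have [lt|ge] := ltnP x 27.
    have [t ->] : exists t, den pinit (start G L) = den (pzero (iota 6 21)) t.
      by eexists; rewrite /pinit 10!den_seq.
    by rewrite zero_reg mem_iota x5 lt.
  rewrite den_reg; first by rewrite /start regE ifN //; apply: contraTneq x5 => ->.
  apply/negP=> xw; have /allP/(_ x xw) : all (fun x => x < 27) (var_writes pinit) by vm_compute.
  by rewrite ltnNge ge.
have [t3 [s3 [ex3 rb le3]]] := loop_ok run cl2 iv2.
exists (bitlen (reg s0 0) + bitlen (ram s0 (reg s0 0)) + (t2 + t3)), s3; split=> //.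
  by apply: exec_Seq ex1 _; apply: exec_Seq ex2 ex3.
rewrite addnA; apply: leq_add le3; rewrite /init_cost; apply: leq_add le2.
rewrite (_ : bitlen _ = 1) // addnC leq_add2r; apply: bitlen_le; first exact: width_gt0.
exact: lt_width.
Qed.

End Run.

Lemma poly_width : poly_bounded width.
Proof.
have c k := poly_const k; have i := poly_id.
have t : poly_bounded (fun n => 3 * n) := poly_mul (c 3) i.
apply: (poly_add (f := fun n => 1 + n * n + 3 * n + (stack_limit n).+1 * (3 * n + 1)) _ (c 1)).
apply: poly_add.
  exact: poly_add (poly_add (c 1) (poly_mul i i)) t.
apply: poly_mul; last exact: poly_add t (c 1).
have [C [k le]] := poly_add (poly_mul (c 6) i) (c 11).
by exists C, k => n; apply: leq_trans (le n); rewrite /stack_limit; lia.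
Qed.

Lemma poly_step_cost : poly_bounded step_cost.
Proof.
have p : poly_bounded step_ops := poly_add (poly_ops _) (poly_const _).
exact: poly_add (poly_mul p (poly_mul (poly_const 2) (poly_add poly_width p))) (poly_const 2).
Qed.

Lemma poly_init_cost : poly_bounded init_cost.
Proof.
have p : poly_bounded init_ops := poly_add (poly_ops _) (poly_const _).
exact: poly_add (poly_add poly_width (poly_const 1))
  (poly_mul p (poly_mul (poly_const 2) (poly_add poly_width p))).
Qed.

Lemma rank_le (T : finType) (f : bool * lists T) : rank f <= 2 * #|T| + 1.
Proof.
rewrite /rank leq_add ?leq_b1 // massE mulnC -sum_nat_const.
by apply: leq_sum => v _; rewrite /wt; case: #|_| => [|[|[|[|k]]]].
Qed.

Lemma rank_limit q n : q <= 2 * n + 1 -> 3 * q + 1 <= stack_limit n.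
Proof. by rewrite /stack_limit; lia. Qed.

Local Open Scope ring_scope.

Theorem theorem1 (R : realType) :
  exists (p : prog) (C k : nat),
    forall (T : finType) (G : sgraph T) (L : list_assignment T),
      (forall v : T, (6 <= degree G v)%N) ->
      exists2 t : nat,
        decides_in p G L t &
        t%:R <= C%:R * (#|T|.+1%:R ^+ k
                        + (13196 / 10000) `^ ((nlist L 3)%:R + 2^-1 * (nlist L 2)%:R)) :> R.
Proof.
have [C [k le]] := poly_add poly_init_cost poly_step_cost.
have [K absorb] := absorb_poly R k.+1.
exists main, (C * 6)%N, K => T G L0 deg6.
pose L : lists T := [ffun v => L0 v].
have eL : encode G L0 = encode G L.
  rewrite /encode; congr (_ :: _ ++ _); congr flatten; apply: eq_map => v.
  by rewrite ffunE.
have eN i : nlist L0 i = nlist L i.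
  by rewrite /nlist; apply: eq_card => v; rewrite !inE ffunE.
have eC : choosable G L0 = choosable G L.
  apply: eq_existsb => f; congr (_ && _).
  by apply: eq_forallb => v; rewrite ffunE.
set n := #|T|; set N : R := n.+1%:R.
have rk : (rank (false, L) <= 2 * n + 1)%N := rank_le (false, L).
have [|j run lej] := @run_lists T G R (stack_limit n) deg6 L; first exact: rank_limit.
have [t [s [ex rb let_]]] := main_ok run.
exists t; first by exists s; rewrite eL eC.
rewrite !eN.
have -> : (nlist L 3)%:R + 2^-1 * (nlist L 2)%:R = 2^-1 * (mass L)%:R :> R.
  by rewrite /mass natrD natrM mulrDr mulKf ?pnatr_eq0.
have b1 : 1 <= beta R ^+ mass L by apply/exprn_ege1/beta_ge1.
have N1 : 1 <= N by rewrite /N ler1n.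
have jle : (j.+1)%:R <= 6 * N * beta R ^+ mass L.
  move: lej; rewrite /charge /potential /= => lej.
  rewrite -natr1; apply: le_trans (lerD lej (lexx 1)) _.
  have rk2 : (rank (false, L)).+1%:R <= 2 * N :> R.
    by rewrite /N -natrM ler_nat mulnS add2n ltnS -[(2 * n).+1]addn1.
  rewrite -addrA (_ : 6 = 2 + 4); last by rewrite -natrD.
  rewrite mulrDl mulrDl; apply: lerD.
    by rewrite mulrC; apply: ler_wpM2r rk2; apply: le_trans b1.
  apply: (@le_trans _ _ 4); first by rewrite -mulr2n ler_nat.
  by rewrite -mulrA ler_peMr // mulr_ege1.
have tle : t%:R <= C%:R * N ^+ k * (j.+1)%:R :> R.
  rewrite /N -!natrX -!natrM ler_nat; apply: leq_trans let_ _.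
  apply: leq_trans (leq_mul (le n) (leqnn j.+1)).
  by rewrite mulnDl leq_add // ?leq_pmulr // mulnC leq_mul.
apply: le_trans tle _.
rewrite natrM -!mulrA; apply: ler_wpM2l => //.
apply: le_trans (ler_wpM2l (exprn_ge0 _ (le_trans ler01 N1)) jle) _.
rewrite mulrA [N ^+ k * _]mulrCA -exprSr -mulrA.
by apply: ler_wpM2l; [rewrite ler0n | exact: absorb].
Qed.
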